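(* Let $p$ be a prime, $t\in\mathbb{N}$, $b_1(X),\ldots,b_t(X)\in\mathbb{F}_p[X]$ monic, nonconstant, pairwise coprime, and let $(\boldsymbol y_n)_{n\ge0}$ be the Halton sequence in these bases. For $L\in\mathcal H$ let $(x_n)_{n\ge0}$ be the digital Kronecker sequence associated with $L$. Then for $h$-almost all $L\in\mathcal H$ the following holds: for every $\epsilon>0$ there is a constant $c=c(p,L,b_1,\ldots,b_t,\epsilon)>0$ such that the star discrepancy of $((x_n,\boldsymbol y_n))_{n\ge0}$ satisfies $ND_N^*\le c\log^{t+1+\epsilon}N$ for all $N\ge2$.
   Context: $\mathcal H$ is the set of $L\in\mathbb{F}_p((X^{-1}))$ with $\nu(L)<0$, where for $L=\sum_{i=w}^\infty a_iX^{-i}$ with $a_w\ne0$, $\nu(L)=-w$ (and $\nu(0)=-\infty$); $h$ is the normalized Haar measure on (the additive compact group) $\mathcal H$. Elements of $\mathbb{F}_p$ are identified with $\{0,\ldots,p-1\}$. For $n=n_0+n_1p+\cdots$ in base $p$, $n(X)=n_0+n_1X+\cdots$. $\{L\}=\sum_{i\ge\max(1,w)}a_iX^{-i}$. Digital Kronecker sequence for $L$: writing $\{n(X)L\}=\sum_{i\ge1}c_iX^{-i}$, $x_n=\sum_{i\ge1}c_ip^{-i}$. Van der Corput sequence in base $b(X)$ (monic, nonconstant, degree $e$): $n(X)=\sum_{i\ge0}a_i(X)b(X)^i$ with $\deg a_i<e$, $y_n=\sum_{i\ge0}a_i(p)p^{-e(i+1)}$; the Halton sequence juxtaposes coordinatewise.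 Star discrepancy: $D_N^*=\sup_B|A_N(B)/N-\lambda(B)|$ over boxes $B=\prod[0,\beta_i)\subseteq[0,1)^{1+t}$, $A_N(B)=\#\{0\le n<N:(x_n,\boldsymbol y_n)\in B\}$. *)

(* Defs.v *)
(* MathComp for polynomials over F_p, Stdlib Reals for the real-valued parts.
   NB: after these imports the delimiter %R denotes MathComp's ring_scope; Stdlib
   real notations are used through  Open Scope R_scope  below. *)
From Stdlib Require Import Reals ClassicalEpsilon.
From HB Require Import structures.
From mathcomp Require Import all_boot all_order all_algebra.
Unset Printing Implicit Defensive.

(* n(X) = n_0 + n_1 X + ... for n = n_0 + n_1 p + ... in base p
   (n.+1 digits suffice since p^n > n). *)
Definition natpoly (p n : nat) : {poly 'F_p} :=
  (\poly_(i < n.+1) (((n %/ p ^ i) %% p)%:R : 'F_p))%R.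

Definition evalp (p : nat) (a : {poly 'F_p}) : nat :=
  \sum_(i < size a) (nat_of_ord (a`_i)%R) * p ^ i.

Definition vdc_digit (p : nat) (b : {poly 'F_p}) (n i : nat) : {poly 'F_p} :=
  ((natpoly p n %/ b ^+ i) %% b)%R.

(* Elements L of H are sum_{i>=1} a_i X^{-i}; encoded as L : nat -> 'F_p with
   L k = a_{k+1}.  kron_coef p L n k = coefficient c_{k+1} of X^{-(k+1)} in
   {n(X) L}, i.e. sum_j n_j a_{k+1+j}. *)
Definition kron_coef (p : nat) (L : nat -> 'F_p) (n k : nat) : 'F_p :=
  (\sum_(j < n.+1) (natpoly p n)`_j * L (k + j))%R.

Definition cyl (p : nat) (s : seq 'F_p) (L : nat -> 'F_p) : Prop :=
  forall i, (i < size s)%N -> L i = nth 0%R s i.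

Open Scope R_scope.

Definition Rlim (u : nat -> R) : R := epsilon (inhabits 0) (fun l => Un_cv u l).

Definition Rltb (x y : R) : bool := if Rlt_dec x y then true else false.

(* Van der Corput sequence in base b(X) of degree e:
   y_n = sum_i a_i(p) p^{-e(i+1)}  (digits with index i > n vanish). *)
Definition vdc (p : nat) (b : {poly 'F_p}) (n : nat) : R :=
  sum_f_R0 (fun i => INR (evalp p (vdc_digit p b n i)) /
                      (INR p ^ ((size b).-1 * i.+1))) n.

Definition kron (p : nat) (L : nat -> 'F_p) (n : nat) : R :=
  Rlim (fun K => sum_f_R0 (fun k => INR (nat_of_ord (kron_coef p L n k)) /
                                     (INR p ^ k.+1)) K).

Definition A_N (p t : nat) (b : 'I_t -> {poly 'F_p}) (L : nat -> 'F_p)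
    (N : nat) (b0 : R) (beta : 'I_t -> R) : nat :=
  (\sum_(n < N) (Rltb (kron p L n) b0 &&
                 [forall i : 'I_t, Rltb (vdc p (b i) n) (beta i)] : nat))%N.

Definition box_vol (t : nat) (b0 : R) (beta : 'I_t -> R) : R :=
  Rmult b0 (\big[Rmult/1]_(i < t) beta i).

Definition star_disc (p t : nat) (b : 'I_t -> {poly 'F_p}) (L : nat -> 'F_p)
    (N : nat) : R :=
  epsilon (inhabits 0) (is_lub (fun r => exists (b0 : R) (beta : 'I_t -> R),
    (0 <= b0 <= 1) /\ (forall i, 0 <= beta i <= 1) /\
    r = Rabs (INR (A_N p t b L N b0 beta) / INR N - box_vol t b0 beta))).

(* Null sets for the normalized Haar measure h on H (= product of uniform
   measures on the digit sequence (a_1, a_2, ...)): for every eps > 0 the set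
   is covered by countably many cylinders of total measure at most eps. *)
Definition haar_null (p : nat) (A : (nat -> 'F_p) -> Prop) : Prop :=
  forall eps : R, 0 < eps -> exists s : nat -> seq 'F_p,
    (forall L, A L -> exists m, cyl p (s m) L) /\
    (forall M, sum_f_R0 (fun m => / (INR p ^ size (s m))) M <= eps).

Definition haar_almost_all (p : nat) (P : (nat -> 'F_p) -> Prop) : Prop :=
  haar_null p (fun L => ~ P L).

(* Main.v *)
(** Let [m] be a power of 2 and [N < p^m]. Cutting [n < N] into blocks on which
    the lower [j] digits of [n] are free, and each Halton coordinate of a box
    into elementary intervals, leaves [O(m^(t+1))] counting problems: among the
    [n] of a block with [n(X) = R] modulo [B = prod_i b_i^(k_i)], how many
    satisfy [x_n < beta_0]?  Writing [d = deg B], [u = j - d] and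
    [n(X) = n_0 + q B] with [q] ranging over [F_p^u], the first [s] digits of
    [x_n] are an affine function of [q] whose linear part is the [u * s] Hankel
    matrix of the digits of [B L].  If this matrix has full rank for
    [s = u - w], every interval of length [p^-s] is hit equally often and the
    counting error is at most [p^w].

    If the rank is not full, some nonzero [c] of degree [< s] gives [u] leading
    zero digits in [{c B L}]; for fixed [c] this has probability [p^-u], so the
    rank fails with probability at most [p^-w].  Although the mean of the error
    [p^w] of one problem diverges, truncating [w] at [W = O(log m)] costs
    nothing almost surely and leaves a mean [O(W)].  Markov's inequality at the
    scales [m = 2^r], with a loss [(r+1)(r+2)] that makes the probabilities
    summable, yields a total error [O(m^(t+1) (log m)^3)] for almost all [L]. *)
Require Import Defs.
From Stdlib Require Import Reals Classical ClassicalEpsilon FunctionalExtensionality Lra.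
From HB Require Import structures.
From mathcomp Require Import all_boot all_order all_algebra.
From mathcomp Require Import Rstruct ring lra zify.
Import Order.TTheory GRing.Theory Num.Theory.
Set Implicit Arguments.
Unset Strict Implicit.

(** * Digits of integers *)

Section Digits.
Local Open Scope nat_scope.

(* Cuts [0, G) into Q-adic intervals: the summand (l, c) is the event that Y
   agrees with G above the digit l, whose value in Y is c. *)
Lemma ltn_digits (Q P M G Y : nat) : 0 < Q -> Q <= P -> G < Q ^ M ->
  (Y < G : nat) = \sum_(l < M) \sum_(c < P)
    (c < (G %/ Q ^ l) %% Q) * (Y %/ Q ^ l == Q * (G %/ Q ^ l.+1) + c).
Proof.
move=> Q0 QP; elim: M G Y => [|M IH] G Y GM.
  by rewrite big_ord0; case: G GM.
have GQ : G %/ Q < Q ^ M by rewrite ltn_divLR // -expnSr.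
rewrite big_ord_recl /= expn0 !divn1 expn1.
have -> : \sum_(i < M) \sum_(c < P) (c < G %/ Q ^ bump 0 i %% Q) *
   (Y %/ Q ^ bump 0 i == Q * (G %/ Q ^ (bump 0 i).+1) + c) = (Y %/ Q < G %/ Q).
  rewrite (IH _ (Y %/ Q) GQ); apply: eq_bigr => i _; apply: eq_bigr => c _.
  by rewrite /bump /= add1n -!divnMA -!expnS.
(* The digit [l = 0] accounts for the last, incomplete block of length [Q]; the higher digits are
   the induction hypothesis applied to the quotients by [Q]. *)
have H : \sum_(c < P) (c < G %% Q) * (Y == Q * (G %/ Q) + c)
       = (Q * (G %/ Q) <= Y < G).
  have [/andP[h1 h2]|h] := boolP (Q * (G %/ Q) <= Y < G).
    have hG := divn_eq G Q; rewrite mulnC in hG.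
    have hc : Y - Q * (G %/ Q) < P.
      by apply: leq_trans QP; have := ltn_pmod G Q0; lia.
    rewrite (bigD1 (Ordinal hc)) //= big1 ?addn0.
      by rewrite subnKC // eqxx muln1; have -> : Y - Q * (G %/ Q) < G %% Q by lia.
    move=> c; rewrite -val_eqE /= => hcn.
    have /negbTE-> : Y != Q * (G %/ Q) + c by apply/eqP; lia.
    by rewrite muln0.
  apply: big1 => c _; apply/eqP; rewrite muln_eq0 !eqb0; apply: contraR h.
  rewrite negb_or !negbK => /andP[h1 /eqP h2].
  by have hG := divn_eq G Q; rewrite mulnC in hG; apply/andP; lia.
rewrite H {H}.
have [hYG|hYG] := ltnP (Y %/ Q) (G %/ Q).
  have h1 : Y < Q * (G %/ Q) by rewrite mulnC -ltn_divLR.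
  have h2 : Q * (G %/ Q) <= G by rewrite mulnC leq_divM.
  by rewrite (leq_trans h1 h2) leqNgt h1.
have h1 : Q * (G %/ Q) <= Y by rewrite mulnC -leq_divRL.
by rewrite h1 addn0.
Qed.

Lemma sum_ltn_ord (g P : nat) : g <= P -> \sum_(c < P) (c < g : nat) = g.
Proof.
move=> gP; rewrite -[RHS]card_ord -sum1_card (big_ord_widen _ (fun=> 1) gP).
by rewrite [RHS]big_mkcond /=; apply: eq_bigr => c _; case: ifP.
Qed.

(** The lengths of the intervals of [ltn_digits], indexed alike so that counts and volumes can be
    subtracted term by term. [P] may exceed [Q] so that several bases can share one summation
    range. *)
Lemma digits_sum (Q P M G : nat) : 0 < Q -> Q <= P -> G < Q ^ M ->
  G = \sum_(l < M) \sum_(c < P) (c < (G %/ Q ^ l) %% Q) * Q ^ l.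
Proof.
move=> Q0 QP GM.
have -> : \sum_(l < M) \sum_(c < P) (c < (G %/ Q ^ l) %% Q) * Q ^ l
        = \sum_(l < M) (G %/ Q ^ l) %% Q * Q ^ l.
  apply: eq_bigr => l _; rewrite -big_distrl /= sum_ltn_ord //.
  by apply: leq_trans QP; apply/ltnW/ltn_pmod.
elim: M G GM => [|M IH] G GM; first by rewrite big_ord0; case: G GM.
have GQ : G %/ Q < Q ^ M by rewrite ltn_divLR // -expnSr.
rewrite big_ord_recl /= expn0 divn1 muln1 {1}(divn_eq G Q) addnC; congr addn.
rewrite {1}(IH _ GQ) big_distrl /=; apply: eq_bigr => l _.
by rewrite /bump /= add1n expnS divnMA -mulnA (mulnC Q).
Qed.

(* The digit [a 0] is the most significant one: [dnum Q a k / Q^k] truncates the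
   expansion [sum_i a_i Q^(-i-1)] after [k] digits. *)
Fixpoint dnum (Q : nat) (a : nat -> nat) (k : nat) : nat :=
  if k is k'.+1 then dnum Q a k' * Q + a k' else 0.

Lemma eq_dnum Q a a' k : (forall i, i < k -> a i = a' i) -> dnum Q a k = dnum Q a' k.
Proof.
elim: k => //= k IH h; rewrite h // IH // => i ik; exact/h/leqW.
Qed.

Lemma dnum_lt Q a k : (forall i, a i < Q) -> dnum Q a k < Q ^ k.
Proof.
move=> h; elim: k => //= k IH; rewrite expnSr.
by have := leq_mul IH (leqnn Q); have := h k; lia.
Qed.

Lemma dnum_div Q a k l : (forall i, a i < Q) -> dnum Q a (k + l) %/ Q ^ l = dnum Q a k.
Proof.
move=> h; have Q0 : 0 < Q by apply: leq_ltn_trans (h 0).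
elim: l => [|l IH]; first by rewrite addn0 expn0 divn1.
by rewrite addnS /= expnS divnMA divnMDl // (divn_small (h _)) addn0.
Qed.

Lemma dnum_inj Q a a' k : (forall i, a i < Q) -> (forall i, a' i < Q) ->
  dnum Q a k = dnum Q a' k -> forall i, i < k -> a i = a' i.
Proof.
move=> h h'; have Q0 : 0 < Q by apply: leq_ltn_trans (h 0).
elim: k => //= k IH e i.
have e1 : a k = a' k.
  by have /(congr1 (modn^~ Q)) := e; rewrite !modnMDl !modn_small.
have e2 : dnum Q a k = dnum Q a' k.
  by have /(congr1 (divn^~ Q)) := e; rewrite !divnMDl // !divn_small // !addn0.
by rewrite ltnS leq_eqVlt => /orP[/eqP-> //|]; apply: IH.
Qed.

Lemma dnum_surj Q k c : 0 < Q -> c < Q ^ k ->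
  exists a, (forall i, a i < Q) /\ dnum Q a k = c.
Proof.
move=> Q0; elim: k c => [|k IH] c ck.
  by exists (fun=> 0); case: c ck.
have [|a [h1 h2]] := IH (c %/ Q); first by rewrite ltn_divLR // -expnSr.
exists (fun i => if i == k then c %% Q else a i); split=> [i|/=].
  by case: ifP => // _; rewrite ltn_mod.
rewrite eqxx (@eq_dnum _ _ a) ?h2 -?divn_eq // => i ik.
by rewrite ltn_eqF.
Qed.

End Digits.

(** * Residue classes of [n(X)] *)

Section NatPoly.
Local Open Scope nat_scope.
Variable (p : nat) (pr : prime p).

Let p0 : 0 < p := prime_gt0 pr.
Let p1 : 1 < p := prime_gt1 pr.

Lemma Fp_lt (x : 'F_p) : x < p.
Proof. by have := ltn_ord x; rewrite [X in _ < X -> _](Fp_cast pr). Qed.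

Lemma coef_natpoly n i : ((natpoly p n)`_i)%R = (((n %/ p ^ i) %% p)%N%:R)%R.
Proof.
rewrite /natpoly coef_poly; case: ltnP => // ni.
rewrite divn_small ?mod0n //; apply: ltn_trans ni _; exact: ltn_expl.
Qed.

(** No carries occur, so an aligned block of [p ^ j] integers becomes a translate of the space of
    polynomials of degree below [j]. *)
Lemma natpoly_block a j l : l < p ^ j ->
  natpoly p (a * p ^ j + l) = (natpoly p a * 'X^j + natpoly p l)%R.
Proof.
move=> lj; apply/polyP=> i; rewrite coefD coefMXn !coef_natpoly.
case: ltnP => [ij|ji].
  rewrite add0r; congr (_%:R)%R.
  have -> : j = (j - i.+1).+1 + i by lia.
  rewrite expnD expnS mulnA divnMDl ?expn_gt0 ?p0 //.
  by rewrite mulnA mulnAC modnMDl.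
have [i' ->] : exists i', i = j + i' by exists (i - j); lia.
rewrite addKn [in X in (_ + X)%R]divn_small; last first.
  by apply: leq_trans lj _; rewrite leq_pexp2l //; lia.
rewrite mod0n addr0 expnD divnMA divnMDl ?expn_gt0 ?p0 //.
by rewrite (divn_small lj) addn0.
Qed.

Lemma size_natpoly n j : n < p ^ j -> size (natpoly p n) <= j.
Proof.
move=> nj; apply/leq_sizeP => i ji; rewrite coef_natpoly divn_small ?mod0n //.
by apply: leq_trans nj _; rewrite leq_pexp2l.
Qed.

Lemma natpoly_small l : l < p -> natpoly p l = ((l%:R : 'F_p)%:P)%R.
Proof.
move=> lp; apply/polyP=> i; rewrite coef_natpoly coefC; case: i => [|i] /=.
  by rewrite expn0 divn1 modn_small.
rewrite divn_small ?mod0n //; apply: leq_trans lp _.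
by rewrite -[X in X <= _]expn1 leq_pexp2l.
Qed.

Lemma natpoly_MD n c : c < p ->
  natpoly p (n * p + c) = (natpoly p n * 'X + (c%:R : 'F_p)%:P)%R.
Proof. by move=> cp; rewrite -natpoly_small // -['X%R]expr1 -natpoly_block ?expn1. Qed.

Lemma evalp_wide (a : {poly 'F_p}) k : size a <= k ->
  evalp p a = \sum_(i < k) (nat_of_ord ((a`_i)%R)) * p ^ i.
Proof.
move=> ak; rewrite /evalp (big_ord_widen _ (fun i => nat_of_ord ((a`_i)%R) * p ^ i) ak).
rewrite big_mkcond /=; apply: eq_bigr => i _; case: ltnP => // ai.
by rewrite nth_default.
Qed.

Lemma evalp_MXaddC (a : {poly 'F_p}) (c : 'F_p) :
  evalp p (a * 'X + c%:P)%R = evalp p a * p + c.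
Proof.
have h : size (a * 'X + c%:P)%R <= (size a).+1.
  apply: leq_trans (size_polyD _ _) _; rewrite geq_max; apply/andP; split.
    by apply: leq_trans (size_polyMleq _ _) _; rewrite size_polyX addn2.
  by apply: leq_trans (size_polyC_leq1 _) _.
have e0 : ((a * 'X + c%:P)`_0 = c)%R by rewrite coefD coefMX coefC add0r.
have eS i : ((a * 'X + c%:P)`_i.+1 = a`_i)%R by rewrite coefD coefMX coefC addr0.
rewrite (evalp_wide h) big_ord_recl expn0 muln1 e0 addnC.
congr addn; rewrite /evalp big_distrl; apply: eq_bigr => i _.
by rewrite lift0 eS expnSr mulnA.
Qed.

Lemma natpolyK : cancel (natpoly p) (evalp p).
Proof.
elim/ltn_ind => n IH; have [n_p|n_p] := ltnP n p.
  rewrite natpoly_small // -[X in evalp p X]add0r -[X in evalp p (X + _)%R](mul0r 'X%R).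
  rewrite evalp_MXaddC (val_Fp_nat pr) modn_small // {1}/evalp size_poly0 big_ord0.
  by rewrite mul0n.
rewrite {1}(divn_eq n p) natpoly_MD ?ltn_pmod // evalp_MXaddC IH; last first.
  by rewrite ltn_Pdiv //; lia.
by rewrite (val_Fp_nat pr) modn_mod -divn_eq.
Qed.

Lemma natpoly0 : natpoly p 0 = 0%R.
Proof. by rewrite natpoly_small. Qed.

Lemma evalpK : cancel (evalp p) (natpoly p).
Proof.
elim/poly_ind => [|a c IH]; first by rewrite /evalp size_poly0 big_ord0 natpoly0.
by rewrite evalp_MXaddC natpoly_MD ?Fp_lt // IH; congr (_ + _%:P)%R; apply: natr_Zp.
Qed.

Lemma evalp_lt (a : {poly 'F_p}) e : size a <= e -> evalp p a < p ^ e.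
Proof.
elim/poly_ind: a e => [|a c IH] e; first by rewrite /evalp size_poly0 big_ord0 expn_gt0 p0.
rewrite evalp_MXaddC => h; case: e h => [|e] h.
  have : (a * 'X + c%:P)%R == 0%R by rewrite -size_poly_eq0; lia.
  rewrite -size_poly_eq0 size_MXaddC; case: ifP => // /andP[/eqP-> /eqP->] _.
  by rewrite /evalp size_poly0 big_ord0.
have : size a <= e.
  move: h; rewrite size_MXaddC; case: ifP => [/andP[/eqP-> _]|//].
  by rewrite size_poly0.
move=> /IH h1; rewrite expnSr; have := leq_mul h1 (leqnn p); have := Fp_lt c; lia.
Qed.

(** [evalp] inverts [natpoly]; passing to row vectors makes a block accessible to linear algebra. *)
Lemma sum_natpoly (T : Type) (idx : T) (op : Monoid.com_law idx) j (f : {poly 'F_p} -> T) :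
  \big[op/idx]_(l < p ^ j) f (natpoly p l) = \big[op/idx]_(v : 'rV['F_p]_j) f (rVpoly v).
Proof.
have hlt (v : 'rV['F_p]_j) : evalp p (rVpoly v) < p ^ j.
  exact/evalp_lt/size_poly.
rewrite (reindex_onto (fun v => Ordinal (hlt v))
   (fun l : 'I_(p ^ j) => poly_rV (natpoly p l))) /=; last first.
  move=> l _; apply/val_inj => /=.
  by rewrite poly_rV_K ?natpolyK // size_natpoly.
by apply: eq_big => [v|v _] /=; rewrite evalpK // rVpolyK eqxx.
Qed.

End NatPoly.

Section Residues.
Local Open Scope ring_scope.
Variable (F : fieldType).
Implicit Types b f g B : {poly F}.

Lemma modp_eqE f g B : (f %% B == g %% B) = (B %| f - g).
Proof. by rewrite -subr_eq0 -modpN -modpD. Qed.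

Lemma coprimep_prodr (I : Type) (s : seq I) (P : pred I) (B : I -> {poly F}) g :
  (forall i, P i -> coprimep g (B i)) -> coprimep g (\prod_(i <- s | P i) B i).
Proof.
move=> h; apply: (big_ind (fun x => coprimep g x)) => //; first exact: coprimep1.
by move=> x y gx gy; rewrite coprimepMr gx.
Qed.

Lemma chinese_poly2 b1 b2 f1 f2 : coprimep b1 b2 ->
  exists f, (b1 %| f - f1) && (b2 %| f - f2).
Proof.
move=> /Bezout_eq1_coprimepP[[u v] /= e].
exists (f1 * (v * b2) + f2 * (u * b1)); apply/andP; split.
  have -> : f1 * (v * b2) + f2 * (u * b1) - f1 = (f2 - f1) * u * b1.
    by rewrite -{2}[f1]mulr1 -e; ring.
  exact: dvdp_mulIr.
have -> : f1 * (v * b2) + f2 * (u * b1) - f2 = (f1 - f2) * v * b2.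
  by rewrite -{2}[f2]mulr1 -e; ring.
exact: dvdp_mulIr.
Qed.

(** Chinese remaindering merges the conditions on all Halton coordinates into a single
    congruence. *)
Lemma chinese_poly (I : eqType) (s : seq I) (B R : I -> {poly F}) : uniq s ->
  (forall i j, i != j -> coprimep (B i) (B j)) ->
  exists R0, forall f, (all (fun i => B i %| f - R i) s) = (\prod_(i <- s) B i %| f - R0).
Proof.
move=> us co; elim: s us => [_|i s IH /= /andP[is_ /IH [R1 h1]]].
  by exists 0 => f; rewrite big_nil dvd1p.
have cop : coprimep (B i) (\prod_(j <- s) B j).
  rewrite big_seq; apply: coprimep_prodr => j js; apply: co.
  by apply: contraNneq is_ => ->.
have [R0 /andP[e1 e2]] := chinese_poly2 (R i) R1 cop.
exists R0 => f; rewrite big_cons Gauss_dvdp //.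
have shift g r1 r2 : g %| r2 - r1 -> (g %| f - r1) = (g %| f - r2).
  by move=> /(dvdp_addl (f - r2)) <-; congr (_ %| _); ring.
by rewrite h1 (shift _ _ _ e1) (shift _ _ _ e2).
Qed.

End Residues.

Section Vdc.
Local Open Scope nat_scope.
Variable (p : nat) (pr : prime p).
Let p0 : 0 < p := prime_gt0 pr.

Definition vdcdig (b : {poly 'F_p}) (f : {poly 'F_p}) (i : nat) : nat :=
  evalp p ((f %/ b ^+ i) %% b)%R.

Definition vbase (b : {poly 'F_p}) : nat := p ^ (size b).-1.

Lemma vdcdig_lt b f i : b != 0%R -> vdcdig b f i < vbase b.
Proof.
move=> b0; apply: (evalp_lt pr); rewrite -ltnS prednK ?size_poly_gt0 //.
exact: ltn_modpN0.
Qed.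

(** The digits are those of the base-[b] expansion of [f], so the first [k] of them carry the same
    information as [f] modulo [b ^+ k]; each further digit refines the modulus by one factor [b]. *)
Lemma vdc_class b k c : b != 0%R -> c < vbase b ^ k ->
  exists R, forall f, (dnum (vbase b) (vdcdig b f) k == c) = (b ^+ k %| f - R)%R.
Proof.
move=> b0; have Q0 : 0 < vbase b by rewrite expn_gt0 p0.
elim: k c => [|k IH] c ck.
  by exists 0%R => f; rewrite expr0 dvd1p /=; case: c ck.
have [|R hR] := IH (c %/ vbase b); first by rewrite ltn_divLR // -expnSr.
have hc0 : c %% vbase b < vbase b by rewrite ltn_mod.
pose r := natpoly p (c %% vbase b).
have sr : size r < size b.
  have := size_natpoly pr hc0.
  by rewrite -/r -ltnS prednK ?size_poly_gt0.
have bk0 : (b ^+ k != 0)%R by rewrite expf_neq0.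
(* The new digit goes on top of the old residue, which is reduced so that it cancels exactly against
   the remainder of [f]. *)
exists (r * b ^+ k + R %% b ^+ k)%R => f /=.
have -> : (dnum (vbase b) (vdcdig b f) k * vbase b + vdcdig b f k == c)
   = (dnum (vbase b) (vdcdig b f) k == c %/ vbase b) && (vdcdig b f k == c %% vbase b).
  have hd := vdcdig_lt f k b0.
  apply/eqP/andP => [<-|[/eqP-> /eqP->]]; last by rewrite -divn_eq.
  by rewrite divnMDl // modnMDl divn_small // modn_small // addn0 !eqxx.
have -> : (vdcdig b f k == c %% vbase b) = (b %| f %/ b ^+ k - r)%R.
  rewrite -modp_eqE [(r %% b)%R]modp_small //.
  by rewrite -(inj_eq (can_inj (evalpK pr))) /r natpolyK.
rewrite hR -modp_eqE.
have e : (f - (r * b ^+ k + R %% b ^+ k) =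
   (f %/ b ^+ k - r) * b ^+ k + (f %% b ^+ k - R %% b ^+ k))%R.
  by rewrite {1}(divp_eq f (b ^+ k)); ring.
rewrite e exprS.
apply/andP/idP => [[/eqP-> h]|h].
  by rewrite subrr addr0 dvdp_mul2r.
have h1 : (b ^+ k %| f %% b ^+ k - R %% b ^+ k)%R.
  rewrite -(dvdp_addr _ (dvdp_mull (f %/ b ^+ k - r)%R (dvdpp (b ^+ k)%R))).
  exact: dvdp_trans (dvdp_mulIr _ _) h.
have h2 : (f %% b ^+ k == R %% b ^+ k)%R.
  by move: h1; rewrite -modp_eqE !(modp_small (ltn_modpN0 _ bk0)).
split=> //; move: h; rewrite (eqP h2) subrr addr0 dvdp_mul2r //.
Qed.

End Vdc.

(** * Hankel matrices of Laurent series *)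

Lemma leq_pred_add (a b c : nat) : (0 < a)%N -> (b <= c)%N -> ((a + b).-1 <= a.-1 + c)%N.
Proof. by lia. Qed.

Lemma pred_lt_add (a b n : nat) : (0 < b)%N -> (n <= (a + b).-1)%N -> (n.-1 < b + a)%N.
Proof. by lia. Qed.

Section FullRank.
Local Open Scope ring_scope.

Lemma row_full_kerP (F : fieldType) (u s : nat) (A : 'M[F]_(u, s)) :
  ~~ row_full A -> exists2 c : 'cV[F]_s, c != 0 & A *m c = 0.
Proof.
move=> nf; have : kermx A^T != 0.
  by rewrite kermx_eq0 /row_free mxrank_tr.
move=> /rowV0Pn[v /sub_kermxP vA v0]; exists v^T.
  by rewrite trmx_eq0.
by apply: trmx_inj; rewrite trmx_mul trmxK vA trmx0.
Qed.

(** With a right-hand section [M] of [A], translation by [(w - v) *m M] carries the fiber over [v]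
    to the one over [w]; hence all fibers have equal size. *)
Lemma card_fiber (F : finFieldType) (u s : nat) (A : 'M[F]_(u, s)) (v : 'rV[F]_s) :
  row_full A -> (#|[set q : 'rV[F]_u | q *m A == v]| * #|F| ^ s = #|F| ^ u)%N.
Proof.
move=> /row_fullP[M MA].
have card_v w : #|[set q : 'rV[F]_u | q *m A == w]| = #|[set q | q *m A == v]|.
  have -> : [set q : 'rV[F]_u | q *m A == w]
          = (fun q => q + (w - v) *m M) @: [set q | q *m A == v].
    apply/setP => q; rewrite inE; apply/eqP/imsetP => [<-|[q' + ->]].
      exists (q - (q *m A - v) *m M); last by rewrite subrK.
      by rewrite inE mulmxBl -mulmxA MA mulmx1 opprB addrC subrK.
    rewrite inE => /eqP qv.
    by rewrite [LHS]mulmxDl -mulmxA MA mulmx1 qv addrC subrK.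
  by rewrite card_imset //; apply: addIr.
have -> : (#|F| ^ u = #|'rV[F]_u|)%N by rewrite card_mx mul1n.
have -> : (#|F| ^ s = #|'rV[F]_s|)%N by rewrite card_mx mul1n.
rewrite -[RHS]sum1_card (partition_big (fun q => q *m A) xpredT) //=.
rewrite mulnC -sum_nat_const; apply: eq_bigr => w _.
by rewrite sum1dep_card card_v.
Qed.

End FullRank.

Section Kdig.
Local Open Scope ring_scope.
Variable (F : fieldType).
Implicit Types (L : nat -> F) (f g B : {poly F}).

(* The coefficient of X^(-k-1) in {f L}. *)
Definition kdig L (k : nat) f : F := \sum_(l < size f) f`_l * L (k + l)%N.

Lemma kdig_wide L k f n : (size f <= n)%N ->
  kdig L k f = \sum_(l < n) f`_l * L (k + l)%N.
Proof.
move=> fn; rewrite /kdig (big_ord_widen _ (fun l => f`_l * L (k + l)%N) fn).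
rewrite big_mkcond /=; apply: eq_bigr => i _; case: ltnP => // ai.
by rewrite nth_default // mul0r.
Qed.

Lemma kdigD L k f g : kdig L k (f + g) = kdig L k f + kdig L k g.
Proof.
rewrite (kdig_wide _ _ (size_polyD f g)).
rewrite (kdig_wide _ _ (leq_maxl (size f) (size g))).
rewrite (kdig_wide _ _ (leq_maxr (size f) (size g))) -big_split /=.
by apply: eq_bigr => l _; rewrite coefD mulrDl.
Qed.

Lemma kdigZ L k a f : kdig L k (a *: f) = a * kdig L k f.
Proof.
rewrite (kdig_wide _ _ (size_scale_leq a f)) mulr_sumr.
by apply: eq_bigr => l _; rewrite coefZ mulrA.
Qed.

Lemma kdig0 L k : kdig L k 0 = 0.
Proof. by rewrite /kdig size_poly0 big_ord0. Qed.

Lemma kdigMXn L k f i : kdig L k (f * 'X^i) = kdig L (k + i) f.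
Proof.
have h : (size (f * 'X^i)%R <= i + size f)%N.
  apply: leq_trans (size_polyMleq _ _) _.
  by rewrite size_polyXn addnS addnC.
rewrite (kdig_wide _ _ h) big_split_ord /= big1 ?add0r.
  by apply: eq_bigr => l _; rewrite coefMXn ltnNge leq_addr /= addKn addnA.
by move=> l _; rewrite coefMXn ltn_ord mul0r.
Qed.

Lemma kdig_sum L k (I : Type) (r : seq I) (G : I -> {poly F}) :
  kdig L k (\sum_(i <- r) G i) = \sum_(i <- r) kdig L k (G i).
Proof. by apply: (big_morph (kdig L k) (kdigD L k) (kdig0 L k)). Qed.

Lemma kdigM L k g B n : (size g <= n)%N ->
  kdig L k (g * B) = \sum_(i < n) g`_i * kdig L (k + i) B.
Proof.
move=> gn; have {1}-> : g = \sum_(i < n) g`_i *: 'X^i.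
  apply/polyP => j; rewrite coef_sum; case: (ltnP j n) => jn.
    rewrite (bigD1 (Ordinal jn)) //= coefZ coefXn eqxx mulr1 big1 ?addr0 // => i.
    by rewrite -val_eqE /= => ij; rewrite coefZ coefXn eq_sym (negbTE ij) mulr0.
  rewrite nth_default ?(leq_trans gn) // big1 // => i _.
  by rewrite coefZ coefXn gtn_eqF ?mulr0 // (leq_trans (ltn_ord i)).
rewrite mulr_suml kdig_sum; apply: eq_bigr => i _.
by rewrite -scalerAl kdigZ mulrC [_ * B]mulrC kdigMXn mulrC.
Qed.

(** Pads a finite row of digits with zeros to a series, so that probabilities over [L] become counts
    over rows. *)
Definition pdig (f : {poly F}) : nat -> F := fun l => f`_l.

(** The Hankel matrix of the Laurent coefficients of {B L}; it sends the coefficients of [q] to the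
    first [s] digits of {q B L}. *)
Definition kronmx L B (u s : nat) : 'M[F]_(u, s) :=
  \matrix_(i, k) kdig L (i + k) B.

Lemma kdig_kronmx L B (u s : nat) (v : 'rV[F]_u) (k : 'I_s) :
  kdig L k (rVpoly v * B) = (v *m kronmx L B u s) 0 k.
Proof.
rewrite (kdigM _ _ _ (size_poly _ _)) !mxE; apply: eq_bigr => i _.
by rewrite !mxE coef_rVpoly_ord addnC.
Qed.

(** The Hankel symmetry lets a column killed by the matrix be read as a polynomial [c] for which {c
    B L} begins with zeros. *)
Lemma kronmx_not_full L B (u s : nat) : ~~ row_full (kronmx L B u s) ->
  exists2 c : 'rV[F]_s, c != 0 &
    forall i, (i < u)%N -> kdig L i (rVpoly c * B) = 0.
Proof.
move=> /row_full_kerP[c c0 Ac]; exists c^T; first by rewrite trmx_eq0.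
move=> i iu; have := congr1 (fun M : 'cV[F]_u => M (Ordinal iu) 0) Ac.
rewrite !mxE => Acl; rewrite -[RHS]Acl (kdigM _ _ _ (size_poly _ _)).
by apply: eq_bigr => k _; rewrite coef_rVpoly_ord !mxE mulrC.
Qed.

End Kdig.

Lemma leq_card_bigcup (T I : finType) (P : pred I) (E : I -> {set T}) :
  (#|\bigcup_(i | P i) E i| <= \sum_(i | P i) #|E i|)%N.
Proof.
apply: (big_ind2 (fun (A : {set T}) n => #|A| <= n)%N) => //; first by rewrite cards0.
move=> A a B c Aa Bc; apply: leq_trans (leq_add Aa Bc).
exact: leq_card_setU.
Qed.

Section CountL.
Local Open Scope ring_scope.
Variable (F : finFieldType).

(** The first [u] digits of {g L} are linear in those of [L], with the coefficients of [g * 'X^i] as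
    columns. A relation between these columns would give [g * h = 0] with [h] nonzero, so the map is
    onto and its fibers are equal. *)
Lemma card_kdig0 (M u : nat) (g : {poly F}) : g != 0 -> ((size g).-1 + u <= M)%N ->
  (#|[set v : 'rV[F]_M | [forall i : 'I_u, (kdig (pdig (rVpoly v)) i g == 0)%R]]|
     * #|F| ^ u = #|F| ^ M)%N.
Proof.
move=> g0 gM; have sg : (0 < size g)%N by rewrite size_poly_gt0.
pose T : 'M[F]_(M, u) := \matrix_(l, i) (g * 'X^i)`_l.
have fT : row_full T.
  apply/negPn/negP => /row_full_kerP[c /eqP c0 Tc]; apply: c0.
  pose h := rVpoly c^T.
  have gh : g * h = 0.
    apply/polyP => l; rewrite coef0; case: (ltnP l M) => lM; last first.
      rewrite nth_default //; apply: leq_trans (size_polyMleq _ _) _.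
      apply: leq_trans lM; apply: leq_trans gM.
      by apply: leq_pred_add => //; apply: size_poly.
    have := congr1 (fun M : 'cV[F]_M => M (Ordinal lM) 0) Tc.
    rewrite !mxE => Tcl; rewrite -[RHS]Tcl {Tcl}.
    have -> : h = \sum_(i < u) c i 0 *: 'X^i.
      by rewrite /h /rVpoly poly_def; apply: eq_bigr => i _; rewrite valK mxE.
    rewrite mulr_sumr coef_sum; apply: eq_bigr => i _.
    by rewrite !mxE -scalerAr coefZ mulrC.
  move/eqP: gh; rewrite mulf_eq0 (negbTE g0) /= => /eqP h0.
  by apply: trmx_inj; rewrite -[LHS]rVpolyK -/h h0 trmx0 linear0.
rewrite -(card_fiber 0 fT); congr (_ * _)%N; apply: eq_card => v; rewrite !inE.
have e (i : 'I_u) : kdig (pdig (rVpoly v)) i g = (v *m T) 0 i.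
  rewrite -[i : nat]add0n -kdigMXn !mxE (@kdig_wide _ _ _ _ M).
    by apply: eq_bigr => l _; rewrite /pdig coef_rVpoly_ord mxE mulrC.
  apply: leq_trans (size_polyMleq _ _) _; rewrite size_polyXn.
  by apply: leq_trans gM; rewrite addnS /= -{1}(prednK sg) addSnnS leq_add2l.
apply/forallP/eqP => [h|h i]; last by rewrite e h mxE.
by apply/rowP => i; rewrite -e (eqP (h i)) mxE.
Qed.

(* Union bound over the nonzero [c] of degree [< s] for which {c B L} starts with
   [u] zero digits. *)
Lemma card_not_full (M u s : nat) (B : {poly F}) : B != 0 ->
  ((size B).-1 + s + u <= M)%N ->
  (#|[set v : 'rV[F]_M | ~~ row_full (kronmx (pdig (rVpoly v)) B u s)]|
     * #|F| ^ u <= #|F| ^ s * #|F| ^ M)%N.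
Proof.
move=> B0 BM.
pose Z (g : {poly F}) :=
  [set v : 'rV[F]_M | [forall i : 'I_u, kdig (pdig (rVpoly v)) i g == 0]].
have sub : [set v : 'rV[F]_M | ~~ row_full (kronmx (pdig (rVpoly v)) B u s)]
  \subset \bigcup_(c : 'rV[F]_s | c != 0) Z (rVpoly c * B).
  apply/subsetP => v; rewrite inE => /kronmx_not_full[c c0 h].
  apply/bigcupP; exists c => //; rewrite inE; apply/forallP => i.
  by rewrite h.
apply: leq_trans (leq_mul (leq_trans (subset_leq_card sub) (leq_card_bigcup _ _)) (leqnn _)) _.
rewrite big_distrl /=.
have -> : (#|F| ^ s = #|'rV[F]_s|)%N by rewrite card_mx mul1n.
(* Including [c = 0] in the upper bound makes the number of choices exactly [#|F| ^ s]. *)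
rewrite -sum_nat_const [X in (_ <= X)%N](bigID (fun c : 'rV[F]_s => c != 0)) /=.
apply: leq_trans (leq_addr _ _); apply: leq_sum => c c0.
have rc0 : rVpoly c != 0.
  by apply: contraNneq c0 => h; rewrite -[c]rVpolyK h linear0.
rewrite card_kdig0 ?mulf_neq0 //; apply: leq_trans BM.
rewrite leq_add2r -ltnS (leq_trans (_ : _ <= (size B + size (rVpoly c)%R))%N) //.
  by apply: pred_lt_add (size_polyMleq _ _); rewrite size_poly_gt0.
rewrite -addSn prednK ?size_poly_gt0 // leq_add2l; exact: size_poly.
Qed.

End CountL.

(** * Counting in blocks, residue classes and boxes *)

Section KronBlocks.
Local Open Scope nat_scope.
Variables (p : nat) (pr : prime p) (L : nat -> 'F_p).
Implicit Types (f B R P : {poly 'F_p}) (g : nat).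
Let p0 : 0 < p := prime_gt0 pr.

Definition xnum (s : nat) f : nat := dnum p (fun k => nat_of_ord (kdig L k f)) s.

Lemma xnum_lt s f : xnum s f < p ^ s.
Proof. by apply: dnum_lt => i; apply: Fp_lt. Qed.

Lemma xnum_div s m f : s <= m -> xnum m f %/ p ^ (m - s) = xnum s f.
Proof. by move=> sm; rewrite -{1}(subnKC sm) dnum_div // => i; apply: Fp_lt. Qed.

Lemma count_xnum_eq B u s f0 c : row_full (kronmx L B u s) -> c < p ^ s ->
  \sum_(q : 'rV['F_p]_u) (xnum s (f0 + rVpoly q * B)%R == c : nat) = p ^ (u - s).
Proof.
move=> full /(dnum_surj p0)[a [ap <-]].
pose v : 'rV['F_p]_s := (\row_k ((a k)%:R - kdig L k f0))%R.
have su : s <= u by rewrite -(eqP full) rank_leq_row.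
have := card_fiber v full; rewrite (card_Fp pr) => e.
apply/eqP; rewrite -(eqn_pmul2r (_ : 0 < p ^ s)) ?expn_gt0 ?p0 //.
rewrite -expnD subnK // -e; apply/eqP; congr (_ * _).
rewrite -sum1dep_card [RHS]big_mkcond /=; apply: eq_bigr => q _.
suff -> : (xnum s (f0 + rVpoly q * B)%R == dnum p a s) = (q *m kronmx L B u s == v)%R.
  by case: eqP.
apply/eqP/eqP => [h|h].
  apply/rowP => k; rewrite -kdig_kronmx mxE.
  have := dnum_inj (fun i => Fp_lt pr _) ap h (ltn_ord k) => /= e1.
  by rewrite -e1 kdigD natr_Zp addrAC subrr add0r.
apply: eq_dnum => i ks; have := congr1 (fun M : 'rV['F_p]_s => M 0%R (Ordinal ks)) h.
rewrite /= -kdig_kronmx mxE /= => e1.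
by rewrite kdigD e1 addrC subrK (val_Fp_nat pr) modn_small.
Qed.

Lemma count_xnum_lt B u s f0 g : row_full (kronmx L B u s) -> g <= p ^ s ->
  \sum_(q : 'rV['F_p]_u) (xnum s (f0 + rVpoly q * B)%R < g : nat) = g * p ^ (u - s).
Proof.
move=> full gs; rewrite -[g in RHS]card_ord -sum_nat_const.
transitivity (\sum_(q : 'rV['F_p]_u) \sum_(c < g)
   (xnum s (f0 + rVpoly q * B)%R == c : nat)).
  apply: eq_bigr => q _; case: ltnP => [h|h].
    rewrite (bigD1 (Ordinal h)) //= eqxx big1 // => c.
    by rewrite -val_eqE /= eq_sym => /negbTE->.
  by rewrite big1 // => c _; case: eqP => // e; have := ltn_ord c; lia.
rewrite exchange_big /=; apply: eq_bigr => c _; apply: count_xnum_eq => //.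
exact: leq_trans (ltn_ord c) gs.
Qed.

(** At the coarser resolution [s] the condition lies between [xnum s < g] and [xnum s < g.+1], both
    of which are counted exactly. *)
Lemma count_xnum_bounds B u s m f0 G : row_full (kronmx L B u s) -> s <= m ->
  G <= p ^ m ->
  G %/ p ^ (m - s) * p ^ (u - s)
  <= \sum_(q : 'rV['F_p]_u) (xnum m (f0 + rVpoly q * B)%R < G : nat)
  <= (G %/ p ^ (m - s)).+1 * p ^ (u - s).
Proof.
move=> full sm Gm; set g := G %/ _; have y0 : 0 < p ^ (m - s) by rewrite expn_gt0 p0.
have su : s <= u by rewrite -(eqP full) rank_leq_row.
have gs : g <= p ^ s.
  by rewrite /g -(mulnK (p ^ s) y0) -expnD subnKC // leq_div2r.
apply/andP; split.
  rewrite -(count_xnum_lt f0 full gs); apply: leq_sum => q _.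
  rewrite -(xnum_div _ sm); case: ltnP => // h; rewrite lt0b.
  rewrite ltnNge; apply/negP => h1; move: h; rewrite ltnNge => /negP; apply.
  by rewrite leq_div2r.
have [h|h] := ltnP g (p ^ s).
  rewrite -(count_xnum_lt f0 full h); apply: leq_sum => q _.
  rewrite -(xnum_div _ sm); case: (ltnP (xnum _ _) G) => // h1.
  by rewrite lt0b ltnS leq_div2r // ltnW.
(* Here [g.+1] exceeds the number of intervals, and the total number of [q] serves as the upper
   bound. *)
apply: leq_trans (_ : \sum_(q : 'rV['F_p]_u) 1 <= _).
  by apply: leq_sum => q _; case: (_ < _).
rewrite sum1_card card_mx mul1n (card_Fp pr) -{1}(subnKC su) expnD leq_mul2r.
by apply/orP; right; apply: leq_trans h _.
Qed.

End KronBlocks.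

Section BlockCount.
Local Open Scope ring_scope.
Variables (K : realFieldType) (p : nat) (pr : prime p) (L : nat -> 'F_p).
Implicit Types (f B R P : {poly 'F_p}) (g : nat).
Let p0 : (0 < p)%N := prime_gt0 pr.
Let pK (n : nat) : 0 < (p ^ n)%:R :> K.
Proof. by rewrite ltr0n expn_gt0 p0. Qed.

(** The count and its expected value both lie between [g] and [g + 1] multiples of [p ^ (u - s)]. *)
Lemma count_xnum_err B u s m f0 G : row_full (kronmx L B u s) -> (s <= m)%N ->
  (G <= p ^ m)%N ->
  `|(\sum_(q : 'rV['F_p]_u) (xnum L m (f0 + rVpoly q * B)%R < G : nat))%N%:R
    - (p ^ u)%:R * (G%:R / (p ^ m)%:R)| <= (p ^ (u - s))%:R :> K.
Proof.
move=> full sm Gm; have := count_xnum_bounds pr f0 full sm Gm.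
set cnt := (\sum_(q : _) _)%N; set g := (G %/ _)%N => /andP[c1 c2].
have su : (s <= u)%N by rewrite -(eqP full) rank_leq_row.
have e : (p ^ u)%:R * (G%:R / (p ^ m)%:R) = (p ^ (u - s))%:R * (G%:R / (p ^ (m - s))%:R) :> K.
  rewrite -{1}(subnKC su) -{1}(subnKC sm) !expnD !natrM.
  have := pK s; have := pK (m - s).
  move: (_%:R) (_%:R : K) => a b; move=> a0 b0; field.
  by rewrite !lt0r_neq0.
rewrite e; set z : K := (p ^ (u - s))%:R; set y : K := (p ^ (m - s))%:R.
have z0 : 0 < z := pK _; have y0 : 0 < y := pK _.
have g1 : g%:R <= G%:R / y.
  by rewrite ler_pdivlMr // -natrM ler_nat leq_divM.
have g2 : G%:R / y <= g%:R + 1.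
  rewrite ler_pdivrMr // natr1 -natrM ler_nat ltnW // mulSn addnC.
  by rewrite {1}(divn_eq G (p ^ (m - s))) ltn_add2l ltn_mod expn_gt0 p0.
have c1' : g%:R * z <= cnt%:R by rewrite -natrM ler_nat.
have c2' : cnt%:R <= (g%:R + 1) * z by rewrite natr1 -natrM ler_nat.
rewrite ler_norml; apply/andP; split; nra.
Qed.

(** If [j < d], a residue class meets the block at most once and the main term is at most 1, whence
    the summand 1. Otherwise the members of the class are [r0 + q * B] with [q] free of [u = j - d]
    coefficients, and the rank hypothesis gives the error [p ^ (u - (u - w))], at most [p ^ w]. *)
Lemma block_err B R P m j w G : B != 0 -> (j <= m)%N -> (G <= p ^ m)%N ->
  let d := (size B).-1 in
  row_full (kronmx L B (j - d) (j - d - w)) ->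
  `|(\sum_(v : 'rV['F_p]_j) ((B %| P + rVpoly v - R)%R &&
        (xnum L m (P + rVpoly v)%R < G)%N : nat))%N%:R
    - (p ^ j)%:R * (G%:R / (p ^ m)%:R) / (p ^ d)%:R| <= 1 + (p ^ w)%:R :> K.
Proof.
move=> B0 jm Gm d full.
have sB : size B = d.+1 by rewrite /d prednK ?size_poly_gt0.
have G1 : 0 <= G%:R / (p ^ m)%:R :> K /\ G%:R / (p ^ m)%:R <= 1 :> K.
  by split; rewrite ?divr_ge0 ?ler0n // ler_pdivrMr ?pK // mul1r ler_nat.
have [jd|dj] := ltnP j d.
  set cnt := (\sum_(v : _) _)%N.
  have c1 : (cnt <= 1)%N.
    apply: leq_trans (_ : cnt <= #|[pred v : 'rV['F_p]_j | (B %| P + rVpoly v - R)%R]|)%N _.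
      rewrite -sum1_card /cnt [X in (_ <= X)%N]big_mkcond /=; apply: leq_sum => v _.
      by rewrite inE; case: (B %| _) => //=; case: (_ < _)%N.
    apply/card_le1_eqP => v v'; rewrite !inE => h h'.
    apply: (can_inj rVpolyK); apply/eqP; rewrite -subr_eq0.
    have : B %| rVpoly v' - rVpoly v.
      have -> : rVpoly v' - rVpoly v = (P + rVpoly v' - R) - (P + rVpoly v - R) by ring.
      by rewrite dvdp_subr.
    apply: contraTT => x0; apply/negP => /(dvdp_leq x0).
    rewrite leqNgt => /negP; apply.
    apply: leq_ltn_trans (size_polyD _ _) _; rewrite size_polyN gtn_max.
    by rewrite sB !(leq_ltn_trans (size_poly _ _)) // ltnS ltnW.
  have e1 : 0 <= (p ^ j)%:R * (G%:R / (p ^ m)%:R) / (p ^ d)%:R :> K /\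
      (p ^ j)%:R * (G%:R / (p ^ m)%:R) / (p ^ d)%:R <= 1 :> K.
    have := pK j; have := pK d => d0 j0; case: G1 => G0 G1.
    split; first by apply: divr_ge0; [apply: mulr_ge0|]; rewrite // ltW.
    rewrite ler_pdivrMr ?pK // mul1r.
    apply: le_trans (_ : (p ^ j)%:R <= _); first by rewrite ler_piMr // ltW.
    by rewrite ler_nat leq_pexp2l // ltnW.
  have c0 : 0 <= cnt%:R :> K /\ cnt%:R <= 1 :> K by rewrite ler0n -[1]/(1%:R) ler_nat.
  have := pK w; move: e1 c0 => [? ?] [? ?] ?.
  rewrite ler_norml; apply/andP; split; lra.
set u := (j - d)%N in full *; set r0 : {poly 'F_p} := (R - P) %% B.
have sr0 : (size r0 <= d)%N by rewrite -ltnS -sB ltn_modp.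
have szh (q : 'rV['F_p]_u) : (size (r0 + rVpoly q * B)%R <= j)%N.
  apply: leq_trans (size_polyD _ _) _; rewrite geq_max (leq_trans sr0 dj) /=.
  apply: leq_trans (size_polyMleq _ _) _; rewrite sB addnS /=.
  by rewrite -(subnK dj) leq_add2r; apply: size_poly.
have Bsz : (size r0 < size B)%N by rewrite ltn_modp.
have e : (\sum_(v : 'rV['F_p]_j) ((B %| P + rVpoly v - R)%R &&
        (xnum L m (P + rVpoly v)%R < G)%N : nat))%N
   = (\sum_(q : 'rV['F_p]_u) (xnum L m ((P + r0) + rVpoly q * B)%R < G : nat))%N.
  rewrite (bigID (fun v : 'rV['F_p]_j => B %| P + rVpoly v - R)) /= [X in (_ + X)%N]big1 ?addn0.
    have divE (q : 'rV['F_p]_u) : (r0 + rVpoly q * B) %/ B = rVpoly q.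
      by rewrite addrC divp_addl_mul_small.
    have dvdE (q : 'rV['F_p]_u) : B %| P + (r0 + rVpoly q * B) - R.
      have -> : P + (r0 + rVpoly q * B) - R = rVpoly q * B + (r0 - (R - P)) by ring.
      by rewrite dvdp_addr ?dvdp_mulIr // -modp_eqE (modp_small Bsz) eqxx.
    rewrite (reindex_onto (fun q : 'rV['F_p]_u => poly_rV (r0 + rVpoly q * B))
        (fun v => poly_rV (rVpoly v %/ B))) /=.
      apply: eq_big => [q|q _]; rewrite poly_rV_K // dvdE ?divE ?rVpolyK ?eqxx //.
      by rewrite addrA.
    move=> v h; rewrite poly_rV_K; last first.
      by rewrite (size_divp _ B0) leq_sub2r //; apply: size_poly.
    rewrite -[RHS]rVpolyK; congr poly_rV.
    rewrite [RHS](divp_eq _ B) addrC; congr (_ + _).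
    apply/eqP; rewrite eq_sym modp_eqE; move: h; congr (_ %| _); ring.
  by move=> v /negbTE->.
rewrite e; have sm : (u - w <= m)%N by rewrite (leq_trans (leq_subr _ _)) // (leq_trans (leq_subr _ _)).
have := count_xnum_err (P + r0) full sm Gm.
have -> : (p ^ j)%:R * (G%:R / (p ^ m)%:R) / (p ^ d)%:R = (p ^ u)%:R * (G%:R / (p ^ m)%:R) :> K.
  have -> : (p ^ j)%:R = (p ^ u)%:R * (p ^ d)%:R :> K by rewrite -natrM -expnD subnK.
  by rewrite [_ * _ * (G%:R / _)]mulrAC mulfK // lt0r_neq0.
move=> h; apply: le_trans h _.
apply: le_trans (_ : (p ^ w)%:R <= _); last by rewrite lerDr.
by rewrite ler_nat leq_pexp2l //; lia.
Qed.

End BlockCount.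

Lemma sum_div_block (F : nat -> nat) (q a T : nat) : (0 < q)%N -> (a.+1 * q <= T)%N ->
  (\sum_(n < T) (n %/ q == a) * F n = \sum_(i < q) F (a * q + i))%N.
Proof.
move=> q0 aT.
have l1 : (a * q <= a.+1 * q)%N by rewrite leq_mul2r leqnSn orbT.
rewrite -(big_mkord xpredT (fun n => (n %/ q == a) * F n))%N.
rewrite (@big_cat_nat _ _ _ (a * q)) //= ?(leq_trans l1) //.
rewrite [X in (_ + X)%N](@big_cat_nat _ _ _ (a.+1 * q)) //=.
rewrite big_nat_cond big1 ?add0n; last first.
  move=> n /andP[/andP[_ h] _]; case: eqP => // e; move: h.
  by rewrite -e ltnNge leq_divM.
rewrite addnC big_nat_cond big1 ?add0n; last first.
  move=> n /andP[/andP[h _] _]; case: eqP => // e; move: h.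
  by rewrite -e leqNgt {1}(divn_eq n q) mulSn addnC ltn_add2r ltn_mod q0.
rewrite -{1}[(a * q)%N]add0n big_addn mulSn addnK big_mkord; apply: eq_bigr => i _.
by rewrite addnC divnMDl // divn_small // addn0 eqxx mul1n.
Qed.

Lemma natr_forall (I : finType) (c : pred I) : ([forall i, c i] : nat) = (\prod_i (c i : nat))%N.
Proof.
have [/forallP h|/forallPn[i ci]] := boolP [forall i, c i].
  by rewrite big1 // => i _; rewrite h.
by rewrite (bigD1 i) //= (negbTE ci).
Qed.

Section ClassCount.
Local Open Scope ring_scope.
Variables (K : realFieldType) (p : nat) (pr : prime p) (L : nat -> 'F_p).
Implicit Types (f B R P : {poly 'F_p}).
Let p0 : (0 < p)%N := prime_gt0 pr.

Definition class_count B R m G N : nat :=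
  (\sum_(n < N) ((B %| natpoly p n - R)%R && (xnum L m (natpoly p n) < G)))%N.

(** The base-[p] digits of [N] cut [n < N] into blocks, at most [p] of them with [j] free digits for
    each [j]. [N] itself splits in the same way, so the errors add up blockwise. *)
Lemma class_err B R m G N (w : nat -> nat) : B != 0 -> (N < p ^ m)%N -> (G <= p ^ m)%N ->
  (forall j, (j < m)%N ->
     row_full (kronmx L B (j - (size B).-1) (j - (size B).-1 - w j))) ->
  `|(class_count B R m G N)%:R - N%:R * (G%:R / (p ^ m)%:R) / (vbase B)%:R|
  <= \sum_(j < m) p%:R * (1 + (p ^ w j)%:R) :> K.
Proof.
move=> B0 Nm Gm full.
pose cond f : nat := (B %| f - R)%R && (xnum L m f < G)%N.
pose pre (l c : nat) := (p * (N %/ p ^ l.+1) + c)%N.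
pose dig l := (N %/ p ^ l %% p)%N.
pose blk (l c : nat) := (\sum_(v : 'rV['F_p]_l) cond (natpoly p (pre l c) * 'X^l + rVpoly v)%R)%N.
have e1 : class_count B R m G N = (\sum_(l < m) \sum_(c < p) (c < dig l) * blk l c)%N.
  transitivity (\sum_(n < p ^ m) (n < N) * cond (natpoly p n))%N.
    rewrite /class_count (big_ord_widen _ (fun n => cond (natpoly p n)) (ltnW Nm)).
    by rewrite big_mkcond /=; apply: eq_bigr => n _; case: (n < N)%N; rewrite ?mul1n.
  transitivity (\sum_(n < p ^ m) \sum_(l < m) \sum_(c < p)
      (c < dig l) * ((n %/ p ^ l == pre l c) * cond (natpoly p n)))%N.
    apply: eq_bigr => n _; rewrite (ltn_digits _ p0 (leqnn p) Nm) big_distrl /=.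
    apply: eq_bigr => l _; rewrite big_distrl /=; apply: eq_bigr => c _.
    by rewrite mulnA.
  rewrite exchange_big /=; apply: eq_bigr => l _.
  rewrite exchange_big /=; apply: eq_bigr => c _.
  rewrite -big_distrr /=; case: (ltnP c (dig l)) => // cd; rewrite !mul1n.
  rewrite (sum_div_block (fun n => cond (natpoly p n))) ?expn_gt0 ?p0 //; last first.
    apply: leq_trans (ltnW Nm); rewrite -leq_divRL ?expn_gt0 ?p0 //.
    by rewrite /pre expnSr divnMA mulnC [X in (_ < X)%N](divn_eq _ p) ltn_add2l.
  rewrite /blk -(sum_natpoly pr addn l (fun f => cond (natpoly p (pre l c) * 'X^l + f)%R)) /=.
  by apply: eq_bigr => i _; rewrite natpoly_block.
have e2 : N%:R = \sum_(l < m) \sum_(c < p) (c < dig l)%:R * (p ^ l)%:R :> K.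
  rewrite {1}(digits_sum p0 (leqnn p) Nm) natr_sum; apply: eq_bigr => l _.
  by rewrite natr_sum; apply: eq_bigr => c _; rewrite natrM.
rewrite e1 e2 natr_sum -mulrA mulr_suml -sumrB.
apply: le_trans (ler_norm_sum _ _ _) _; apply: ler_sum => l _.
rewrite natr_sum mulr_suml -sumrB.
apply: le_trans (ler_norm_sum _ _ _) _.
have -> : p%:R * (1 + (p ^ w l)%:R) = \sum_(c < p) (1 + (p ^ w l)%:R) :> K.
  by rewrite sumr_const card_ord mulr_natl.
apply: ler_sum => c _.
rewrite natrM -[_ * _ * (_ / _)]mulrA -mulrBr normrM normr_nat [_ * (_ / _)]mulrA.
have H := block_err K pr R (natpoly p (pre l c) * 'X^l)%R B0 (ltnW (ltn_ord l)) Gm (full l (ltn_ord l)).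
apply: le_trans H; rewrite /blk /cond.
by case: (_ < _)%N; rewrite ?mul1r ?mul0r ?normr_ge0.
Qed.

End ClassCount.

Section BoxCount.
Local Open Scope ring_scope.
Variables (K : realFieldType) (p : nat) (pr : prime p) (L : nat -> 'F_p).
Variables (t : nat) (b : 'I_t -> {poly 'F_p}).
Hypothesis b0 : forall i, b i != 0.
Hypothesis bco : forall i j, i != j -> coprimep (b i) (b j).
Let p0 : (0 < p)%N := prime_gt0 pr.

Definition ynum m i f : nat := dnum (vbase (b i)) (vdcdig (b i) f) m.

(* [l i] counts the base-[b i] digits, among the first [m], left unconstrained. *)
Definition bprod m (l : {ffun 'I_t -> 'I_m.+1}) : {poly 'F_p} :=
  \prod_i b i ^+ (m - l i).

Definition box_count m G0 (G : 'I_t -> nat) N : nat :=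
  (\sum_(n < N) ((xnum L m (natpoly p n) < G0) &&
     [forall i, ynum m i (natpoly p n) < G i]))%N.

Lemma vbase_gt0 (f : {poly 'F_p}) : (0 < vbase f)%N.
Proof. by rewrite expn_gt0 p0. Qed.

Lemma vbase1 : vbase (1 : {poly 'F_p}) = 1%N.
Proof. by rewrite /vbase size_poly1. Qed.

Lemma vbaseM (f g : {poly 'F_p}) : f != 0 -> g != 0 -> vbase (f * g) = (vbase f * vbase g)%N.
Proof.
move=> f0 g0; rewrite /vbase size_mul // -expnD; congr (_ ^ _)%N.
move: f0 g0; rewrite -!size_poly_gt0; case: (size f) => // a; case: (size g) => // c _ _.
by rewrite addnS.
Qed.

Lemma vbaseX (f : {poly 'F_p}) k : f != 0 -> vbase (f ^+ k) = (vbase f ^ k)%N.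
Proof.
move=> f0; elim: k => [|k IH]; first by rewrite expr0 vbase1.
by rewrite exprS vbaseM ?expf_neq0 // IH expnS.
Qed.

Lemma vbase_prod (I : Type) (s : seq I) (f : I -> {poly 'F_p}) :
  (forall i, f i != 0) -> vbase (\prod_(i <- s) f i) = (\prod_(i <- s) vbase (f i))%N.
Proof.
move=> f0; elim: s => [|i s IH]; first by rewrite !big_nil vbase1.
rewrite !big_cons vbaseM ?IH //.
apply: (big_ind (fun x => x != 0)) => [|x y|j _]; first exact: oner_neq0.
  exact: mulf_neq0.
exact: f0.
Qed.

Lemma bprod_neq0 m (l : {ffun 'I_t -> 'I_m.+1}) : bprod l != 0.
Proof. by apply/prodf_neq0 => i _; rewrite expf_neq0. Qed.

Lemma ynum_div m i f l : (l <= m)%N ->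
  (ynum m i f %/ vbase (b i) ^ l = dnum (vbase (b i)) (vdcdig (b i) f) (m - l))%N.
Proof.
move=> lm; rewrite /ynum -{1}(subnK lm) dnum_div // => k.
exact: (vdcdig_lt pr f k (b0 i)).
Qed.

Lemma box_class m (l : {ffun 'I_t -> 'I_m.+1}) (a : 'I_t -> nat) :
  (forall i, a i < vbase (b i) ^ (m - l i))%N ->
  exists R, forall f, [forall i, (ynum m i f %/ vbase (b i) ^ l i)%N == a i]
    = (bprod l %| f - R).
Proof.
move=> am.
have h i : exists R, forall f, ((ynum m i f %/ vbase (b i) ^ l i)%N == a i)
      = (b i ^+ (m - l i) %| f - R).
  have [R hR] := vdc_class pr (b0 i) (am i).
  by exists R => f; rewrite ynum_div ?hR // -ltnS.
have [R hR] := fin_all_exists h.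
have co i j : i != j -> coprimep (b i ^+ (m - l i)) (b j ^+ (m - l j)).
  by move=> ij; rewrite coprimep_expl // coprimep_expr // bco.
have [R0 hR0] := chinese_poly R (index_enum_uniq _) co.
exists R0 => f; rewrite -hR0; apply/forallP/allP => [H i _|H i].
  by rewrite -hR.
by rewrite hR H // mem_index_enum.
Qed.

(** Expanding the product of the one-dimensional decompositions cuts the Halton box into elementary
    boxes, each a residue class modulo some [bprod l]; [P ^ t] bounds the number of digit vectors
    for one [l]. *)
Lemma box_err m G0 G N P (e : {ffun 'I_t -> 'I_m.+1} -> K) :
  (forall i, vbase (b i) <= P)%N -> (forall i, G i <= vbase (b i) ^ m)%N ->
  (forall i, 1 < vbase (b i))%N ->
  (forall l R, `|(class_count L (bprod l) R m G0 N)%:R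
     - N%:R * (G0%:R / (p ^ m)%:R) / (vbase (bprod l))%:R| <= e l) ->
  `|(box_count m G0 G N)%:R
     - N%:R * (G0%:R / (p ^ m)%:R) * \prod_i ((G i)%:R / (vbase (b i) ^ m)%:R)|
  <= (P ^ t)%:R * \sum_l e l.
Proof.
move=> QP GQ Q1 he.
(* [G i] may equal [vbase (b i) ^ m], when the side has length 1; this takes [m.+1] digits, hence
   the range of [l]. *)
have GQ' i : (G i < vbase (b i) ^ m.+1)%N.
  by apply: leq_ltn_trans (GQ i) _; rewrite ltn_exp2l.
pose dig i l := (G i %/ vbase (b i) ^ l %% vbase (b i))%N.
pose pre i l c := (vbase (b i) * (G i %/ vbase (b i) ^ l.+1) + c)%N.
pose ok (l : {ffun 'I_t -> 'I_m.+1}) (c : {ffun 'I_t -> 'I_P}) :=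
  (\prod_i (c i < dig i (l i) : nat))%N.
pose cl (l : {ffun 'I_t -> 'I_m.+1}) (c : {ffun 'I_t -> 'I_P}) : nat :=
  (\sum_(n < N) ((xnum L m (natpoly p n) < G0) &&
    [forall i, (ynum m i (natpoly p n) %/ vbase (b i) ^ l i) == pre i (l i) (c i)]))%N.
have e1 : box_count m G0 G N = (\sum_l \sum_c ok l c * cl l c)%N.
  rewrite /box_count.
  transitivity (\sum_(n < N) \sum_l \sum_c ok l c * ((xnum L m (natpoly p n) < G0) &&
    [forall i, (ynum m i (natpoly p n) %/ vbase (b i) ^ l i) == pre i (l i) (c i)]))%N.
    apply: eq_bigr => n _; rewrite -mulnb natr_forall.
    under eq_bigr => i _ do rewrite (ltn_digits _ (vbase_gt0 _) (QP i) (GQ' i)).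
    rewrite bigA_distr_bigA big_distrr /=; apply: eq_bigr => l _.
    rewrite bigA_distr_bigA big_distrr /=; apply: eq_bigr => c _.
    by rewrite big_split /= -mulnb natr_forall mulnCA.
  rewrite exchange_big /=; apply: eq_bigr => l _.
  rewrite exchange_big /=; apply: eq_bigr => c _.
  by rewrite -big_distrr.
have e2 : \prod_i ((G i)%:R / (vbase (b i) ^ m)%:R) =
   \sum_l \sum_c (ok l c)%:R / (vbase (bprod l))%:R :> K.
  transitivity (\prod_i \sum_(l < m.+1) \sum_(c < P)
     ((c < dig i l)%N%:R / (vbase (b i) ^ (m - l))%:R) : K).
    apply: eq_bigr => i _.
    rewrite {1}(digits_sum (vbase_gt0 _) (QP i) (GQ' i)) natr_sum mulr_suml.
    apply: eq_bigr => l _; rewrite natr_sum mulr_suml; apply: eq_bigr => c _.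
    have lm : (l <= m)%N by rewrite -ltnS.
    have -> : (vbase (b i) ^ m = vbase (b i) ^ (m - l) * vbase (b i) ^ l)%N.
      by rewrite -expnD subnK.
    rewrite !natrM -mulrA invfM [X in _ * X]mulrCA mulfV ?mulr1 //.
    by rewrite pnatr_eq0 -lt0n expn_gt0 vbase_gt0.
  rewrite bigA_distr_bigA; apply: eq_bigr => l _.
  rewrite bigA_distr_bigA; apply: eq_bigr => c _.
  rewrite big_split /= /ok natr_prod prodfV; congr (_ / _).
  rewrite /bprod vbase_prod => [|i]; last by rewrite expf_neq0.
  by rewrite natr_prod; apply: eq_bigr => i _; rewrite vbaseX.
rewrite e1 e2 natr_sum mulr_sumr -sumrB mulr_sumr.
apply: le_trans (ler_norm_sum _ _ _) _; apply: ler_sum => l _.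
rewrite natr_sum mulr_sumr -sumrB.
apply: le_trans (ler_norm_sum _ _ _) _.
have -> : (P ^ t)%:R * e l = \sum_(c : {ffun 'I_t -> 'I_P}) e l.
  by rewrite sumr_const card_ffun !card_ord mulr_natl.
apply: ler_sum => c _.
(* Nonnegativity covers the digit vectors [c] that contribute no elementary box. *)
have e0 : 0 <= e l by apply: le_trans (he l 0).
have [/forallP okc|/forallPn[i nok]] := boolP [forall i, c i < dig i (l i)]%N; last first.
  have -> : ok l c = 0%N by rewrite /ok (bigD1 i) //= (negbTE nok).
  by rewrite mul0n !mul0r mulr0 subr0 normr0.
have -> : ok l c = 1%N by rewrite /ok big1 // => i _; rewrite okc.
have [|R hR] := @box_class m l (fun i => pre i (l i) (c i)).
  move=> i; have lm : (l i <= m)%N by rewrite -ltnS.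
  apply: (@leq_trans (G i %/ vbase (b i) ^ l i)).
    rewrite /pre expnSr divnMA mulnC [X in (_ < X)%N](divn_eq _ (vbase (b i))) ltn_add2l.
    exact: okc.
  have q0 : (0 < vbase (b i) ^ l i)%N by rewrite expn_gt0 vbase_gt0.
  rewrite -(leq_pmul2r q0).
  by rewrite -expnD subnK // (leq_trans (leq_divM _ _)).
have -> : cl l c = class_count L (bprod l) R m G0 N.
  by apply: eq_bigr => n _; rewrite -hR andbC.
by rewrite mul1n mul1r; apply: he.
Qed.

End BoxCount.

(** * The exceptional set *)

Section BadDigits.
Local Open Scope nat_scope.
Variables (p : nat) (pr : prime p) (t : nat) (b : 'I_t -> {poly 'F_p}).
Hypothesis b0 : forall i, (b i != 0)%R.
Implicit Type B : {poly 'F_p}.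
Let p0 : 0 < p := prime_gt0 pr.

Definition bad (L : nat -> 'F_p) B u w : bool := ~~ row_full (kronmx L B u (u - w)).

(* The factor [p^w] cancels the probability of [bad], so that each term has mean
   at most 1. *)
Definition bad_weight m W (L : nat -> 'F_p) : nat :=
  \sum_(l : {ffun 'I_t -> 'I_m.+1}) \sum_(j < m) \sum_(w < W.+1)
     p ^ w * bad L (bprod b l) (j - (size (bprod b l)).-1) w.

(** Truncated subtraction leaves a matrix without columns, which has full rank; so a good level
    always exists. *)
Lemma bad_id L B u w : u <= w -> bad L B u w = false.
Proof.
move=> uw; apply/negbTE; rewrite negbK /row_full.
have -> : u - w = 0 by apply/eqP; rewrite subn_eq0.
by rewrite -leqn0 rank_leq_col.
Qed.

(** Only finitely many digits enter the matrix. The guard [0 < u] matters because an empty matrix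
    reads no digit, however large the degree of [B]. *)
Lemma eq_bad M L L' B u w : (forall x, x < M -> L x = L' x) ->
  (0 < u -> (size B).-1 + u + u <= M) -> bad L B u w = bad L' B u w.
Proof.
move=> LL' BM; congr (~~ row_full _); apply/matrixP => i k; rewrite !mxE.
apply: eq_bigr => l _; congr (_ * _)%R; apply: LL'.
have u0 : 0 < u by apply: leq_ltn_trans (ltn_ord i).
have aux (x y z s : nat) : s.-1 + u + u <= M -> x < u -> y < u - w -> z < s -> x + y + z < M.
  by lia.
exact: aux (BM u0) (ltn_ord i) (ltn_ord k) (ltn_ord l).
Qed.

(** Explains why [2 * m] digits of [L] suffice: for [d < j] the left side is [2 * j - d]. *)
Lemma block_digits (d j m : nat) : j < m -> 0 < j - d -> d + (j - d) + (j - d) <= 2 * m.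
Proof. by lia. Qed.

Lemma eq_bad_weight m W L L' : (forall x, x < 2 * m -> L x = L' x) ->
  bad_weight m W L = bad_weight m W L'.
Proof.
move=> LL'; apply: eq_bigr => l _; apply: eq_bigr => j _; apply: eq_bigr => w _.
by congr (_ * nat_of_bool _); apply: eq_bad LL' _; apply: block_digits.
Qed.

(** The probability of being bad is at most [p ^ (u - w) / p ^ u], by the union bound with
    [s = u - w]. *)
Lemma sum_bad M B u w : (B != 0)%R -> (0 < u -> (size B).-1 + u + u <= M) ->
  \sum_(v : 'rV['F_p]_M) p ^ w * bad (pdig (rVpoly v)) B u w <= p ^ M.
Proof.
move=> B0 BM; have [uw|wu] := leqP u w.
  by rewrite big1 // => v _; rewrite bad_id // muln0.
have u0 : 0 < u by lia.
have h : (size B).-1 + (u - w) + u <= M by have := BM u0; lia.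
have := card_not_full B0 h; rewrite (card_Fp pr).
rewrite -big_distrr /=.
set c := #|_| => hc.
have -> : \sum_(v : 'rV['F_p]_M) bad (pdig (rVpoly v)) B u w = c.
  rewrite /c -sum1dep_card [RHS]big_mkcond /=; apply: eq_bigr => v _.
  by rewrite /bad; case: (row_full _).
rewrite -(leq_pmul2l (_ : 0 < p ^ (u - w))) ?expn_gt0 ?p0 //.
by rewrite mulnA -expnD subnK ?(ltnW wu) // mulnC.
Qed.

Lemma sum_bad_weight m W :
  \sum_(v : 'rV['F_p]_(2 * m)) bad_weight m W (pdig (rVpoly v))
   <= m.+1 ^ t * m * W.+1 * p ^ (2 * m).
Proof.
rewrite exchange_big /=.
have -> : m.+1 ^ t * m * W.+1 * p ^ (2 * m) =
   \sum_(l : {ffun 'I_t -> 'I_m.+1}) \sum_(j < m) \sum_(w < W.+1) p ^ (2 * m).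
  by rewrite !sum_nat_const card_ffun !card_ord !mulnA.
apply: leq_sum => l _; rewrite exchange_big /=; apply: leq_sum => j _.
rewrite exchange_big /=; apply: leq_sum => w _; apply: sum_bad.
  exact: bprod_neq0.
exact: block_digits.
Qed.

Lemma markov_card (T : finType) (f : T -> nat) (c : nat) :
  #|[set v | c <= f v]| * c <= \sum_v f v.
Proof.
rewrite -sum_nat_const big_mkcond /=; apply: leq_sum => v _.
by rewrite inE; case: ifP.
Qed.

(** Markov's inequality: a weight of at least [k] times the mean bound has probability at most
    [1 / k]. *)
Lemma card_bad_weight m W k : 0 < m ->
  #|[set v : 'rV['F_p]_(2 * m) |
      m.+1 ^ t * m * W.+1 * k <= bad_weight m W (pdig (rVpoly v))]| * k <= p ^ (2 * m).
Proof.
move=> m0; set S := [set v | _]; have c0 : 0 < m.+1 ^ t * m * W.+1.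
  by rewrite !muln_gt0 expn_gt0 m0.
rewrite -(leq_pmul2l c0) mulnCA mulnA -mulnA.
by apply: leq_trans (sum_bad_weight m W); apply: markov_card.
Qed.

(* [w l j] is the least good level: the level just below it is bad, hence its
   weight is counted in [bad_weight] unless it exceeds [W], which [T <= p^W]
   excludes. *)
Lemma good_levels m W T L : bad_weight m W L < T -> T <= p ^ W ->
  exists w : {ffun 'I_t -> 'I_m.+1} -> nat -> nat,
   (forall l j, j < m ->
     row_full (kronmx L (bprod b l) (j - (size (bprod b l)).-1)
        (j - (size (bprod b l)).-1 - w l j)))
   /\ \sum_l \sum_(j < m) p ^ (w l j) <= m.+1 ^ t * m + p * bad_weight m W L.
Proof.
move=> GT TW.
pose d l := (size (@bprod _ _ b m l)).-1.
have ex l j : exists w, ~~ bad L (bprod b l) (j - d l) w.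
  by exists (j - d l); rewrite bad_id.
exists (fun l j => ex_minn (ex l j)); split.
  by move=> l j jm; case: ex_minnP => w; rewrite /bad negbK.
have -> : m.+1 ^ t * m = \sum_(l : {ffun 'I_t -> 'I_m.+1}) \sum_(j < m) 1.
  by rewrite !sum_nat_const card_ffun !card_ord muln1.
have bad_le (l : {ffun 'I_t -> 'I_m.+1}) (j : 'I_m) w : w <= W -> bad L (bprod b l) (j - d l) w ->
    p ^ w <= \sum_(w < W.+1) p ^ w * bad L (bprod b l) (j - d l) w.
  move=> wW bw; rewrite (bigD1 (Ordinal (wW : w < W.+1))) //= bw muln1.
  exact: leq_addr.
rewrite /bad_weight big_distrr -big_split /=; apply: leq_sum => l _.
rewrite big_distrr -big_split /=; apply: leq_sum => j _.
case: ex_minnP => [[|w]] nb minw; first by rewrite expn0 leq_addr.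
have bw w' : w' <= w -> bad L (bprod b l) (j - d l) w'.
  by move=> w'w; have [//|/minw] := boolP (bad L (bprod b l) (j - d l) w'); lia.
apply: leq_trans (leq_addl _ _); rewrite expnS leq_mul2l; apply/orP; right.
have [wW|Ww] := leqP w W; first exact/bad_le/bw.
(* If [w] exceeds [W], then by minimality level [W] is bad as well, and its weight [p ^ W] alone
   reaches [T]. *)
move: GT; rewrite ltnNge (leq_trans TW) //.
apply: leq_trans (bad_le l j W (leqnn _) (bw _ (ltnW Ww))) _.
rewrite /bad_weight (bigD1 l) //= (bigD1 j) //=.
by rewrite -addnA leq_addr.
Qed.

End BadDigits.

Section BoxBound.
Local Open Scope ring_scope.
Variables (K : realFieldType) (p : nat) (pr : prime p) (L : nat -> 'F_p).
Variables (t : nat) (b : 'I_t -> {poly 'F_p}).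
Hypothesis b0 : forall i, b i != 0.
Hypothesis b1 : forall i, (1 < size (b i))%N.
Hypothesis bco : forall i j, i != j -> coprimep (b i) (b j).

(** In [p + 2], one [T] covers the summands 1 of the block errors, one covers the levels [w = 0],
    and [p * T] covers the weighted bad levels; the outer [p] counts the blocks of equal length. *)
Lemma box_bound m W T G0 G N P :
  (bad_weight b m W L < T)%N -> (T <= p ^ W)%N -> (m.+1 ^ t * m <= T)%N ->
  (N < p ^ m)%N -> (G0 <= p ^ m)%N ->
  (forall i, vbase (b i) <= P)%N -> (forall i, G i <= vbase (b i) ^ m)%N ->
  `|(box_count L b m G0 G N)%:R
     - N%:R * (G0%:R / (p ^ m)%:R) * \prod_i ((G i)%:R / (vbase (b i) ^ m)%:R)|
  <= (P ^ t * (p * (p + 2)) * T)%:R :> K.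
Proof.
move=> GT TW IT Nm G0m QP GQ.
have [w [full sw]] := good_levels pr GT TW.
have Q1 i : (1 < vbase (b i))%N.
  by rewrite -[X in (X < _)%N](expn0 p) ltn_exp2l ?prime_gt1 //; have := b1 i; case: size => [|[]].
pose e l := \sum_(j < m) p%:R * (1 + (p ^ w l j)%:R) : K.
apply: le_trans (box_err (e := e) pr b0 bco QP GQ Q1 _) _.
  move=> l R; apply: class_err => //; first exact: bprod_neq0.
  by move=> j jm; apply: full.
rewrite -mulnA natrM; apply: ler_wpM2l; first exact: ler0n.
have -> : \sum_l e l = (p * (m.+1 ^ t * m + \sum_l \sum_(j < m) p ^ w l j))%:R :> K.
  rewrite natrM natrD natr_sum /e mulrDr.
  have -> : (m.+1 ^ t * m)%:R = \sum_(l : {ffun 'I_t -> 'I_m.+1}) m%:R :> K.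
    by rewrite sumr_const card_ffun !card_ord natrM mulr_natl.
  rewrite !mulr_sumr -big_split /=; apply: eq_bigr => l _.
  rewrite -mulr_sumr big_split /= -mulrDr natr_sum; congr (_ * (_ + _)).
  by rewrite sumr_const card_ord.
rewrite ler_nat -mulnA leq_mul2l; apply/orP; right.
apply: leq_trans (leq_add (leqnn _) sw) _.
have : (p * bad_weight b m W L <= p * T)%N by rewrite leq_mul2l ltnW ?orbT.
rewrite mulnDl; lia.
Qed.

End BoxBound.

(** * Real points and the star discrepancy *)

Lemma digit_step (K : fieldType) (x y z w : K) : z != 0%R -> w != 0%R ->
  (y / (z * w) = (x * w + y) / (z * w) - x / z)%R.
Proof. by move=> z0 w0; field; rewrite z0 w0. Qed.

Section DigitExpansions.
Local Open Scope ring_scope.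
Variables (Q : nat) (a : nat -> nat).
Hypothesis aQ : forall i, (a i < Q)%N.

Let Q0 : (0 < Q)%N.
Proof. exact: leq_ltn_trans (aQ 0). Qed.
Let qR n : 0 < (Q ^ n)%:R :> R.
Proof. by rewrite ltr0n expn_gt0 Q0. Qed.

Definition digit_sum (n : nat) : R := ((dnum Q a n)%:R / (Q ^ n)%:R)%R.

Lemma sum_f_R0_digits n :
  sum_f_R0 (fun k => Rdiv (INR (a k)) (pow (INR Q) k.+1)) n = digit_sum n.+1.
Proof.
have step k : Rdiv (INR (a k)) (pow (INR Q) k.+1) = digit_sum k.+1 - digit_sum k.
  rewrite RdivE RpowE !INRE /digit_sum /= expnSr !natrM natrD !natrM natrX exprSr.
  have q0 : Q%:R != 0 :> R by rewrite pnatr_eq0 -lt0n Q0.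
  exact: digit_step (expf_neq0 k q0) q0.
rewrite sum_f_R0E (telescope_sumr_eq digit_sum) => [|//|k _]; last exact: step.
by rewrite /digit_sum [dnum Q a 0]/= mul0r subr0.
Qed.

Lemma digit_sum_mono n m : (n <= m)%N -> digit_sum n <= digit_sum m.
Proof.
move=> nm; have e : (Q ^ m = Q ^ n * Q ^ (m - n))%N by rewrite -expnD subnKC.
rewrite /digit_sum ler_pdivrMr // mulrAC ler_pdivlMr //.
rewrite -!natrM ler_nat e mulnCA [(_ * Q ^ n)%N]mulnC leq_mul2l.
by apply/orP; right; rewrite -(dnum_div n (m - n) aQ) subnKC // leq_divM.
Qed.

Lemma digit_sum_le n m : digit_sum n <= (dnum Q a m).+1%:R / (Q ^ m)%:R.
Proof.
apply: le_trans (digit_sum_mono (leq_maxl n m)) _.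
have mn := leq_maxr n m; move: (maxn n m) mn => k mk.
have e : (Q ^ k = Q ^ m * Q ^ (k - m))%N by rewrite -expnD subnKC.
rewrite /digit_sum ler_pdivrMr // mulrAC ler_pdivlMr //.
rewrite -!natrM ler_nat e mulnCA [(_ * Q ^ m)%N]mulnC leq_mul2l.
apply/orP; right; rewrite -(dnum_div m (k - m) aQ) subnKC // ltnW //.
by rewrite mulSn addnC {1}(divn_eq (dnum Q a k) (Q ^ (k - m))) ltn_add2l ltn_mod expn_gt0 Q0.
Qed.

(** The truncations increase and stay within one cell. The limit may reach the right end of the
    cell, so both inequalities are weak. *)
Lemma digit_sum_lim l m : Un_cv (fun n => digit_sum n.+1) l ->
  (dnum Q a m)%:R <= (Q ^ m)%:R * l /\ (Q ^ m)%:R * l <= (dnum Q a m).+1%:R.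
Proof.
move=> cv; split; rewrite mulrC.
  rewrite -ler_pdivrMr //.
  have grow : Un_growing (fun n => digit_sum n.+1) by move=> n; apply/RleP/digit_sum_mono.
  apply: le_trans (digit_sum_mono (leqnSn m)) _.
  exact/RleP/(growing_ineq _ _ grow cv).
rewrite -ler_pdivlMr //; apply/RleP.
apply: (@Rle_cv_lim _ (fun=> (dnum Q a m).+1%:R / (Q ^ m)%:R) _ _ _ cv).
  by move=> n; apply/RleP/digit_sum_le.
by move=> e e0; exists 0 => n _; rewrite Rdist_eq.
Qed.

Lemma digit_sum_cv : exists l, Un_cv (fun n => digit_sum n.+1) l.
Proof.
have grow : Un_growing (fun n => digit_sum n.+1) by move=> n; apply/RleP/digit_sum_mono.
have [|l cv] := growing_cv _ grow; last by exists l.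
exists ((dnum Q a 0).+1%:R / (Q ^ 0)%:R) => x [n ->].
exact/RleP/digit_sum_le.
Qed.

End DigitExpansions.

Section PointBounds.
Local Open Scope ring_scope.
Variables (p : nat) (pr : prime p) (L : nat -> 'F_p).

Lemma Rlim_cv u : (exists l, Un_cv u l) -> Un_cv u (Rlim u).
Proof. by move=> h; apply: epsilon_spec. Qed.

Lemma kron_coefE n k : kron_coef p L n k = kdig L k (natpoly p n).
Proof. by rewrite (@kdig_wide _ _ _ _ n.+1) // size_poly. Qed.

Lemma kron_bounds n m :
  (xnum L m (natpoly p n))%:R <= (p ^ m)%:R * kron p L n /\
  (p ^ m)%:R * kron p L n <= (xnum L m (natpoly p n)).+1%:R.
Proof.
have h i : (nat_of_ord (kdig L i (natpoly p n)) < p)%N by apply: Fp_lt.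
have -> : kron p L n
    = Rlim (fun K => digit_sum p (fun i => nat_of_ord (kdig L i (natpoly p n))) K.+1).
  rewrite /kron; congr Rlim; apply: functional_extensionality => K.
  by rewrite -(sum_f_R0_digits h); apply: PartSum.sum_eq => k _; rewrite kron_coefE.
exact/(digit_sum_lim h)/Rlim_cv/(digit_sum_cv h).
Qed.

Lemma vdc_bounds (b : {poly 'F_p}) n m : (1 < size b)%N ->
  (dnum (vbase b) (vdcdig b (natpoly p n)) m)%:R <= (vbase b ^ m)%:R * vdc p b n /\
  (vbase b ^ m)%:R * vdc p b n <= (dnum (vbase b) (vdcdig b (natpoly p n)) m).+1%:R.
Proof.
move=> b1; have b0 : b != 0 by rewrite -size_poly_gt0 ltnW.
have h i : (vdcdig b (natpoly p n) i < vbase b)%N := vdcdig_lt pr _ _ b0.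
have pw k : pow (INR p) ((size b).-1 * k)%N = pow (INR (vbase b)) k.
  by rewrite !RpowE !INRE /vbase natrX -exprM.
(* For [i > n] the degree of [b ^+ i] exceeds that of [n(X)]. The finite sum in [vdc] is thus the
   limit of the full digit expansion. *)
have z i : (n < i)%N -> vdcdig b (natpoly p n) i = 0%N.
  move=> ni; rewrite /vdcdig divp_small ?mod0p; first by rewrite /evalp size_poly0 big_ord0.
  have sn : (size (natpoly p n) <= i)%N by apply: leq_trans (size_poly _ _) _.
  have sb : size (b ^+ i) = ((size b).-1 * i).+1.
    by rewrite -size_exp prednK // size_poly_gt0 expf_neq0.
  apply: leq_ltn_trans sn _; rewrite sb ltnS leq_pmull //.
  by case: (size b) b1 => [|[]].
have st k : digit_sum (vbase b) (vdcdig b (natpoly p n)) (n + k).+1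
          = digit_sum (vbase b) (vdcdig b (natpoly p n)) n.+1.
  elim: k => [|k IH]; first by rewrite addn0.
  have dS q a j : dnum q a j.+1 = (dnum q a j * q + a j)%N by [].
  rewrite -IH addnS /digit_sum dS (z (n + k).+1) ?ltnS ?leq_addr // addn0.
  rewrite expnSr !natrM -mulf_div divff ?mulr1 // pnatr_eq0 -lt0n.
  exact: vbase_gt0.
have -> : vdc p b n = digit_sum (vbase b) (vdcdig b (natpoly p n)) n.+1.
  by rewrite -(sum_f_R0_digits h) /vdc; apply: PartSum.sum_eq => k _; rewrite -pw.
apply: digit_sum_lim => // e e0; exists n => k /ssrnat.leP nk.
by rewrite -(subnKC nk) st Rdist_eq.
Qed.

End PointBounds.

Section RealBoxes.
Local Open Scope ring_scope.

(* An expansion ending in digits [Q - 1] may sit at the right end of its cell, so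
   the lower approximation has to drop one more cell. *)
Lemma floor_approx (beta : R) (q : nat) : (0 < q)%N -> 0 <= beta <= 1 ->
  exists gl gu : nat, [/\ (gl <= q)%N, (gu <= q)%N,
    `|beta - gl%:R / q%:R| <= 2 / q%:R, `|beta - gu%:R / q%:R| <= 2 / q%:R
  & forall (X : nat) (x : R), (X < q)%N ->
      X%:R <= q%:R * x /\ q%:R * x <= X.+1%:R ->
      ((X < gl)%N -> x < beta) /\ (x < beta -> (X < gu)%N)].
Proof.
move=> q0 /andP[beta0 beta1]; have qR : 0 < q%:R :> R by rewrite ltr0n.
have bq0 : 0 <= q%:R * beta by rewrite mulr_ge0 // ltW.
have /andP[] := Num.Theory.truncn_itv bq0.
set g := Num.truncn _ => g1 g2.
have gq : (g <= q)%N.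
  by rewrite -(ler_nat R); apply: le_trans g1 _; rewrite ler_piMr // ltW.
have err (h : nat) : `|q%:R * beta - h%:R| <= 2 -> `|beta - h%:R / q%:R| <= 2 / q%:R.
  move=> h3; rewrite ler_pdivlMr // -[X in _ * X]gtr0_norm // -normrM.
  by rewrite mulrBl divfK ?lt0r_neq0 // mulrC.
exists g.-1, (minn g.+1 q); split.
- exact: leq_trans (leq_pred _) gq.
- exact: geq_minr.
- have gp : g.-1%:R <= g%:R :> R by rewrite ler_nat leq_pred.
  have gm : g%:R - 1 <= g.-1%:R :> R by rewrite lerBlDr natr1 ler_nat leqSpred.
  by apply: err; rewrite -natr1 in g2; rewrite ler_norml; apply/andP; split; lra.
- have gp : (minn g.+1 q)%:R <= g%:R + 1 :> R by rewrite natr1 ler_nat geq_minl.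
  have gm : g%:R <= (minn g.+1 q)%:R :> R by rewrite ler_nat leq_min leqnSn gq.
  by apply: err; rewrite -natr1 in g2; rewrite ler_norml; apply/andP; split; lra.
move=> X x Xq [X1 X2]; split=> [Xg|xb].
  rewrite -(ltr_pM2l qR); apply: le_lt_trans X2 _; apply: lt_le_trans g1.
  by rewrite ltr_nat; case: g Xg {g2 gq err}.
rewrite leq_min Xq andbT -(ltr_nat R); apply: le_lt_trans X1 _.
by apply: lt_trans g2; rewrite ltr_pM2l.
Qed.

(** Factors are exchanged one at a time, all the others being at most 1. *)
Lemma prod_sub_le (K : realFieldType) (I : Type) (s : seq I) (x y : I -> K) :
  (forall i, 0 <= x i <= 1) -> (forall i, 0 <= y i <= 1) ->
  `|\prod_(i <- s) x i - \prod_(i <- s) y i| <= \sum_(i <- s) `|x i - y i|.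
Proof.
move=> x01 y01; elim: s => [|i s IH]; first by rewrite !big_nil subrr normr0.
rewrite !big_cons.
have -> : x i * \prod_(j <- s) x j - y i * \prod_(j <- s) y j
  = (x i - y i) * \prod_(j <- s) x j
    + y i * (\prod_(j <- s) x j - \prod_(j <- s) y j) by ring.
apply: le_trans (ler_normD _ _) _; rewrite !normrM; apply: lerD.
  rewrite ler_piMr ?normr_ge0 // ger0_norm.
    by apply: prodr_ile1 => j _; apply: x01.
  by apply: prodr_ge0 => j _; case/andP: (x01 j).
case/andP: (y01 i) => yi0 yi1; rewrite (ger0_norm yi0).
by apply: le_trans IH; rewrite ler_piMl ?normr_ge0.
Qed.

End RealBoxes.

Section StarDiscrepancy.
Local Open Scope ring_scope.
Variables (p : nat) (pr : prime p) (L : nat -> 'F_p).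
Variables (t : nat) (b : 'I_t -> {poly 'F_p}).
Hypothesis b1 : forall i, (1 < size (b i))%N.
Hypothesis bco : forall i j, i != j -> coprimep (b i) (b j).
Let p0 : (0 < p)%N := prime_gt0 pr.
Let b0 i : b i != 0.
Proof. by rewrite -size_poly_gt0 ltnW. Qed.

Lemma Defs_RltbP (x y : R) : reflect (x < y) (Defs.Rltb x y).
Proof.
rewrite /Defs.Rltb; case: Rlt_dec => h /=; first exact/ReflectT/RltP.
by apply: ReflectF => /RltP.
Qed.

(** The box is squeezed between two boxes with corners on the grid of resolution [m]. Each side
    moves by at most [2 / p ^ m], and [N < p ^ m] turns this into at most 2 points for each of the
    [t.+1] coordinates. *)
Lemma count_err m W T N P beta0 beta :
  (bad_weight b m W L < T)%N -> (T <= p ^ W)%N -> (m.+1 ^ t * m <= T)%N ->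
  (N < p ^ m)%N -> (forall i, vbase (b i) <= P)%N ->
  0 <= beta0 <= 1 -> (forall i, 0 <= beta i <= 1) ->
  `|(A_N p t b L N beta0 beta)%:R - N%:R * (beta0 * \prod_i beta i)|
  <= (P ^ t * (p * (p + 2)) * T + 2 * t.+1)%:R :> R.
Proof.
move=> GT TW IT Nm QP be0 be.
have pm0 : (0 < p ^ m)%N by rewrite expn_gt0 p0.
have Qm0 i : (0 < vbase (b i) ^ m)%N by rewrite expn_gt0 vbase_gt0.
have [gl0 [gu0 [gl0q gu0q gl0e gu0e g0P]]] := floor_approx pm0 be0.
have ex i := floor_approx (Qm0 i) (be i).
have [gl {}ex] := fin_all_exists ex.
have [gu {}ex] := fin_all_exists ex.
have lo : (box_count L b m gl0 gl N <= A_N p t b L N beta0 beta)%N.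
  apply: leq_sum => n _; case: andP => // -[h0 /forallP h].
  have -> : Defs.Rltb (kron p L n) beta0.
    apply/Defs_RltbP; have [H _] := g0P _ _ (xnum_lt pr L m _) (kron_bounds pr L n m).
    exact: H.
  rewrite lt0b; apply/forallP => i; apply/Defs_RltbP.
  have [_ _ _ _ gP] := ex i.
  have [H _] := gP _ _ (dnum_lt m (fun j => vdcdig_lt pr _ j (b0 i))) (vdc_bounds pr n m (b1 i)).
  exact/H/h.
have hi : (A_N p t b L N beta0 beta <= box_count L b m gu0 gu N)%N.
  apply: leq_sum => n _; case: andP => // -[/Defs_RltbP h0 /forallP h].
  have -> : (xnum L m (natpoly p n) < gu0)%N.
    have [_ H] := g0P _ _ (xnum_lt pr L m _) (kron_bounds pr L n m).
    exact: H.
  rewrite lt0b; apply/forallP => i.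
  have [_ _ _ _ gP] := ex i.
  have [_ H] := gP _ _ (dnum_lt m (fun j => vdcdig_lt pr _ j (b0 i))) (vdc_bounds pr n m (b1 i)).
  exact/H/Defs_RltbP/h.
pose vol g0 (g : 'I_t -> nat) : R :=
  (g0%:R / (p ^ m)%:R * \prod_i ((g i)%:R / (vbase (b i) ^ m)%:R))%R.
have volE g0 (g : 'I_t -> nat) : (g0 <= p ^ m)%N -> (forall i, g i <= vbase (b i) ^ m)%N ->
    `|beta0 - g0%:R / (p ^ m)%:R| <= 2 / (p ^ m)%:R ->
    (forall i, `|beta i - (g i)%:R / (vbase (b i) ^ m)%:R| <= 2 / (vbase (b i) ^ m)%:R) ->
    `|N%:R * vol g0 g - N%:R * (beta0 * \prod_i beta i)| <= (2 * t.+1)%:R.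
  move=> g0q gq g0e ge.
  (* [None] stands for the Kronecker coordinate, so that all sides form one product. *)
  pose x (o : option 'I_t) := if o is Some i then beta i else beta0.
  pose y (o : option 'I_t) : R :=
    if o is Some i then ((g i)%:R / (vbase (b i) ^ m)%:R)%R else (g0%:R / (p ^ m)%:R)%R.
  pose s := None :: [seq Some i | i <- index_enum 'I_t].
  have frac01 (c q : nat) : (0 < q)%N -> (c <= q)%N -> 0 <= ((c%:R / q%:R)%R : R) <= 1.
    move=> q0 cq; rewrite divr_ge0 ?ler0n //= ler_pdivrMr ?ltr0n //.
    by rewrite mul1r ler_nat.
  have x01 o : 0 <= x o <= 1 by case: o => [i|]; [exact: be|exact: be0].
  have y01 o : 0 <= y o <= 1 by case: o => [i|]; [apply: frac01 (Qm0 i) (gq i)|apply: frac01 pm0 g0q].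
  have := prod_sub_le s y01 x01; rewrite /s !big_cons !big_map /= => h.
  rewrite -mulrBr normrM normr_nat.
  apply: le_trans (ler_wpM2l (ler0n _ N) h) _.
  have hN (q : nat) (r : R) : (p ^ m <= q)%N -> r <= 2 / q%:R -> N%:R * r <= 2.
    move=> pq hr; have q0 : 0 < q%:R :> R by rewrite ltr0n (leq_trans pm0).
    apply: le_trans (ler_wpM2l (ler0n _ N) hr) _.
    rewrite mulrCA ler_piMr // ler_pdivrMr // mul1r ler_nat.
    exact: leq_trans (ltnW Nm) pq.
  have pQ i : (p ^ m <= vbase (b i) ^ m)%N.
    have [->|m0] := posnP m; first by rewrite !expn0.
    rewrite leq_exp2r //.
    rewrite -{1}[p]expn1 leq_pexp2l //.
    by case: (size (b i)) (b1 i) => [|[]].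
  rewrite mulnS natrD mulrDr; apply: lerD.
    by apply: (hN (p ^ m)%N) => //; rewrite distrC.
  rewrite mulr_sumr.
  have -> : (2 * t)%:R = \sum_(i < t) 2 :> R by rewrite sumr_const card_ord mulnC natrM mulr_natl.
  apply: ler_sum => i _; apply: (hN (vbase (b i) ^ m)%N) => //.
  by rewrite distrC.
have Bl := box_bound R pr b0 b1 bco GT TW IT Nm gl0q QP (fun i => let: And5 h _ _ _ _ := ex i in h).
have Bu := box_bound R pr b0 b1 bco GT TW IT Nm gu0q QP (fun i => let: And5 _ h _ _ _ := ex i in h).
have Vl := volE _ _ gl0q (fun i => let: And5 h _ _ _ _ := ex i in h) gl0e
   (fun i => let: And5 _ _ h _ _ := ex i in h).
have Vu := volE _ _ gu0q (fun i => let: And5 _ h _ _ _ := ex i in h) gu0e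
   (fun i => let: And5 _ _ _ h _ := ex i in h).
rewrite -mulrA -/(vol _ _) in Bl; rewrite -mulrA -/(vol _ _) in Bu.
rewrite -(ler_nat R) in lo; rewrite -(ler_nat R) in hi.
rewrite natrD; move: Bl Bu Vl Vu lo hi; rewrite !ler_norml.
move=> /andP[? ?] /andP[? ?] /andP[? ?] /andP[? ?] ? ?.
apply/andP; split; lra.
Qed.

(** Since [star_disc] is chosen by [epsilon], the supremum must first be shown to exist: the set is
    nonempty, and [count_err] bounds it uniformly over all boxes. *)
Lemma star_disc_bound m W T N P :
  (bad_weight b m W L < T)%N -> (T <= p ^ W)%N -> (m.+1 ^ t * m <= T)%N ->
  (0 < N)%N -> (N < p ^ m)%N -> (forall i, vbase (b i) <= P)%N ->
  N%:R * star_disc p t b L N <= (P ^ t * (p * (p + 2)) * T + 2 * t.+1)%:R.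
Proof.
move=> GT TW IT N0 Nm QP; have NR : 0 < N%:R :> R by rewrite ltr0n.
rewrite -ler_pdivlMl //.
pose E r := exists (b0 : R) (beta : 'I_t -> R),
    (Rle 0 b0 /\ Rle b0 1) /\ (forall i, Rle 0 (beta i) /\ Rle (beta i) 1) /\
    r = Rabs (Rminus (Rdiv (INR (A_N p t b L N b0 beta)) (INR N)) (box_vol t b0 beta)).
have ub : is_upper_bound E (N%:R^-1 * (P ^ t * (p * (p + 2)) * T + 2 * t.+1)%:R).
  move=> r [c0 [c [[c0l c0u] [cb ->]]]]; apply/RleP.
  rewrite ler_pdivlMl // RabsE RminusE RdivE !INRE -[X in X * _]gtr0_norm // -normrM.
  rewrite mulrBr mulrC divfK ?lt0r_neq0 //; apply: (count_err GT TW IT Nm QP).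
    by apply/andP; split; apply/RleP.
  by move=> i; have [? ?] := cb i; apply/andP; split; apply/RleP.
have ne : exists r, E r.
  exists (Rabs (Rminus (Rdiv (INR (A_N p t b L N 0 (fun=> 0))) (INR N)) (box_vol t 0 (fun=> 0)))).
  have h01 : Rle 0 0 /\ Rle 0 1 by split; apply/RleP; rewrite ?lexx ?ler01.
  by exists 0, (fun=> 0).
have [l lubl] : exists l, is_lub E l.
  by have [l h] := completeness E (ex_intro _ _ ub) ne; exists l.
have [_ H] : is_lub E (star_disc p t b L N) by apply: epsilon_spec; exists l.
exact/RleP/H.
Qed.

End StarDiscrepancy.

(** * Null sets *)

Section Concat.
Local Open Scope ring_scope.
Variables (T : eqType) (x0 : T) (ls : nat -> seq T).
Hypothesis ls_ne : forall k, (0 < size (ls k))%N.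

Let fl n := flatten [seq ls k | k <- iota 0 n].
(** Every list is nonempty, so the first [m.+1] lists have more than [m] entries and the default is
    never read. *)
Definition concat_seq (m : nat) : T := nth x0 (fl m.+1) m.

Lemma size_fl n : (n <= size (fl n))%N.
Proof.
elim: n => [|n IH] //; rewrite /fl -addn1 iotaD map_cat flatten_cat size_cat /= cats0.
by rewrite add0n leq_add // -/(fl n).
Qed.

Lemma concat_seqE n i : (i < size (fl n))%N -> concat_seq i = nth x0 (fl n) i.
Proof.
have flD a c : fl (a + c) = fl a ++ flatten [seq ls k | k <- iota a c].
  by rewrite /fl iotaD map_cat flatten_cat add0n.
move=> ifl; rewrite /concat_seq; have [ni|ni] := ltnP i n.
  by rewrite -(subnKC ni) flD nth_cat size_fl.
have [j ->] : exists j, i.+1 = n + j by exists (i.+1 - n)%N; lia.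
by rewrite flD nth_cat ifl.
Qed.

Lemma concat_seq_cover k x : x \in ls k -> exists m, concat_seq m = x.
Proof.
move=> xk; have xfl : x \in fl k.+1.
  rewrite /fl -addn1 iotaD map_cat flatten_cat mem_cat /= cats0 add0n xk.
  exact: orbT.
exists (index x (fl k.+1)); by rewrite (@concat_seqE k.+1) ?nth_index ?index_mem.
Qed.

Lemma concat_seq_sum (w : T -> R) n : (forall x, 0 <= w x) ->
  \sum_(0 <= m < n) w (concat_seq m) <= \sum_(0 <= k < n) \sum_(x <- ls k) w x.
Proof.
move=> w0.
have -> : \sum_(0 <= k < n) \sum_(x <- ls k) w x = \sum_(x <- fl n) w x.
  by rewrite big_flatten big_map /index_iota subn0.
rewrite (big_nth x0) (big_cat_nat (leq0n _) (size_fl n)) /=.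
apply: ler_wpDr; first by apply: sumr_ge0.
rewrite le_eqVlt; apply/orP; left; apply/eqP; apply: eq_big_nat => i /andP[_ i_n].
by rewrite (@concat_seqE n) ?(leq_trans i_n (size_fl n)).
Qed.

End Concat.

Section NullSets.
Local Open Scope ring_scope.
Variables (p : nat) (pr : prime p).
Let p0 : (0 < p)%N := prime_gt0 pr.

(** The Borel-Cantelli argument: for every [r0] the cylinders from [S r] with [r0 <= r] cover the
    limsup set, and their total measure is a tail of a convergent series. *)
Lemma haar_null_limsup (M : nat -> nat) (S : forall r, {set 'rV['F_p]_(M r)}) :
  (forall r, #|S r| * (r.+1 * r.+2) <= p ^ M r)%N ->
  haar_null p (fun L => forall r0, exists2 r, (r0 <= r)%N & (\row_i L i) \in S r).
Proof.
move=> hS eps /RltP eps0.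
(* The cylinders of [S r] and the filler each contribute at most [1 / ((r+1)(r+2))]; the sum from
   [r0] on telescopes to at most [2 / (r0+1)]. *)
have [r0 hr0] : exists r0 : nat, 2 / r0.+1%:R <= eps :> R.
  exists (Num.truncn (2 / eps)).
  have h := Num.Theory.truncnS_gt (2 / eps).
  rewrite ler_pdivrMr ?ltr0n // mulrC -ler_pdivrMr //; exact: ltW.
pose row_seq r (v : 'rV['F_p]_(M r)) := mkseq (fun i => (rVpoly v)`_i) (M r).
(* The enumeration must be infinite even if the sets [S r] are empty; the filler
   cylinders are as small as the bound on [S r]. *)
pose filler r : seq 'F_p := nseq (r.+1 * r.+2) 0.
pose ls k := rcons [seq row_seq (r0 + k)%N v | v <- enum (S (r0 + k)%N)] (filler (r0 + k)%N).
have ls_ne k : (0 < size (ls k))%N by rewrite size_rcons.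
exists (concat_seq [::] ls); split.
  move=> L /(_ r0)[r r0r LS].
  have rs : row_seq r (\row_i L i) \in ls (r - r0)%N.
    rewrite /ls; move: (subnKC r0r) => e; rewrite e.
    by rewrite mem_rcons inE map_f ?orbT // mem_enum.
  have [m hm] := concat_seq_cover [::] ls_ne rs; exists m; rewrite hm => i.
  rewrite size_mkseq => iM; rewrite nth_mkseq //.
  by rewrite (coef_rVpoly_ord (\row_i L i) (Ordinal iM)) mxE.
move=> n; rewrite sum_f_R0E.
pose w (s : seq 'F_p) : R := Rinv (pow (INR p) (size s)).
have wE s : w s = (p ^ size s)%:R^-1 by rewrite /w RpowE INRE natrX.
have w0 s : 0 <= w s by rewrite wE invr_ge0 ler0n.
apply/RleP; apply: le_trans (concat_seq_sum [::] ls_ne n.+1 w0) _.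
have bound k : \sum_(x <- ls k) w x <= 2 / ((r0 + k).+1 * (r0 + k).+2)%:R.
  rewrite /ls; move: (r0 + k)%N => r; rewrite -cats1 big_cat /= big_seq1 big_map.
  have K0 : 0 < (r.+1 * r.+2)%:R :> R by rewrite ltr0n.
  have -> : 2 / (r.+1 * r.+2)%:R = (r.+1 * r.+2)%:R^-1 + (r.+1 * r.+2)%:R^-1 :> R.
    by rewrite mulr_natl mulr2n.
  apply: lerD.
    rewrite (eq_bigr (fun=> (p ^ M r)%:R^-1)); last by move=> v _; rewrite wE size_mkseq.
    rewrite big_enum /= sumr_const -[_ *+ #|_|]mulr_natl ler_pdivrMr ?ltr0n ?expn_gt0 ?p0 //.
    by rewrite mulrC ler_pdivlMr // -natrM ler_nat; exact: hS.
  rewrite wE size_nseq lef_pV2 ?posrE ?ltr0n ?expn_gt0 ?p0 // ler_nat.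
  exact/ltnW/ltn_expl/prime_gt1.
apply: le_trans (ler_sum _ (fun k _ => bound k)) _.
apply: le_trans hr0.
have step k : 2 / ((r0 + k).+1 * (r0 + k).+2)%:R
     = - (2 / (r0 + k.+1).+1%:R) - - (2 / (r0 + k).+1%:R) :> R.
  rewrite addnS natrM -[(r0 + k).+2%:R]natr1.
  have : 0 < (r0 + k).+1%:R :> R by rewrite ltr0n.
  move: (_.+1%:R : R) => y y0; field.
  by rewrite !lt0r_neq0 // addr_gt0.
rewrite (telescope_sumr_eq (fun k => - (2 / (r0 + k).+1%:R))) //.
by rewrite addn0 opprK addrC gerDl oppr_le0 divr_ge0 ?ler0n.
Qed.

End NullSets.

(** * Growth of the thresholds *)

Section Thresholds.
Local Open Scope nat_scope.

(** The truncation level [W] at scale [m = 2 ^ r], of order [log m]; the factor 10 is a generous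
    choice for [threshold_depth]. *)
Definition depth t r : nat := 10 * (r.+1 * t.+1).

(** The mean bound of [sum_bad_weight] at [m = 2 ^ r], times the Markov loss [r.+1 * r.+2]. *)
Definition threshold t r : nat :=
  (2 ^ r).+1 ^ t * 2 ^ r * (depth t r).+1 * (r.+1 * r.+2).

Lemma threshold_volume t r : (2 ^ r).+1 ^ t * 2 ^ r <= 2 ^ t * (2 ^ r) ^ t.+1.
Proof.
rewrite [in leqRHS]expnSr mulnA leq_mul2r -expnMn; apply/orP; right.
case: t => // t; rewrite leq_exp2r // mul2n -addnn -addn1 leq_add2l.
by rewrite expn_gt0.
Qed.

(** One factor [r.+1] comes from the truncation depth and two from the Markov loss. *)
Lemma threshold_le t r : threshold t r <= 2 ^ t * 22 * t.+1 * ((2 ^ r) ^ t.+1 * r.+1 ^ 3).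
Proof.
rewrite /threshold -mulnA.
apply: leq_trans (leq_mul (threshold_volume t r) (_ : _ <= 22 * t.+1 * r.+1 ^ 3)) _.
  have h : (depth t r).+1 <= 11 * (r.+1 * t.+1) by rewrite /depth; lia.
  have h' : r.+1 * r.+2 <= 2 * (r.+1 * r.+1) by nia.
  apply: leq_trans (leq_mul h h') _.
  by rewrite !expnS expn0; nia.
by rewrite leq_eqVlt; apply/orP; left; apply/eqP; ring.
Qed.

Lemma threshold_depth p t r : 1 < p -> threshold t r <= p ^ depth t r.
Proof.
move=> p1; apply: (@leq_trans (2 ^ depth t r)); last first.
  by rewrite leq_exp2r // muln_gt0.
rewrite /threshold /depth; set a := r.+1 * t.+1.
have a0 : 0 < a by rewrite muln_gt0.
have h0 : (2 ^ r).+1 ^ t * 2 ^ r <= 2 ^ a.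
  apply: leq_trans (threshold_volume t r) _.
  rewrite -expnM -expnD leq_exp2l // /a; nia.
have h1 : r.+1 <= a by rewrite /a; nia.
have h2 : a <= 2 ^ a by apply/ltnW/ltn_expl.
(* Rounding the constant up to [2 ^ 5] and using [a <= 2 ^ a] leaves only the comparison of
   exponents [4 * a + 5 <= 10 * a]. *)
have h3 : (10 * a).+1 * (r.+1 * r.+2) <= (32 * a) * (a * a).
  apply: leq_trans (_ : (11 * a) * (a * (2 * a)) <= _); last by nia.
  by apply: leq_mul; [lia|apply: leq_mul; lia].
rewrite -mulnA; apply: leq_trans (leq_mul h0 h3) _.
apply: leq_trans (_ : 2 ^ a * (2 ^ 5 * 2 ^ a * (2 ^ a * 2 ^ a)) <= _).
  by rewrite leq_mul2l; apply/orP; right; rewrite !leq_mul.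
by rewrite -!expnD leq_exp2l //; lia.
Qed.

Lemma threshold_gt0 t r : 0 < threshold t r.
Proof. by rewrite !muln_gt0 !expn_gt0. Qed.

Lemma threshold_ge t r : (2 ^ r).+1 ^ t * 2 ^ r <= threshold t r.
Proof. by rewrite /threshold -mulnA leq_pmulr. Qed.

(** Here [h] stands for the logarithm of [N], and [2 ^ r] is comparable to it. Forcing [r0 <= r]
    costs the factor [2 ^ r0.+1], which will enter the constant depending on [L]. *)
Lemma level_exists p N r0 : 1 < p -> 1 < N ->
  exists r, [/\ r0 <= r, N < p ^ (2 ^ r) & exists2 h, 2 ^ h <= N ^ 2 & 2 ^ r <= 2 ^ r0.+1 * h].
Proof.
move=> p1 N1; have N0 : 0 < N by lia.
have /andP[h1 h2] := trunc_log_bounds p1 N0; set h := trunc_log p N in h1 h2.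
have /andP[k1 k2] := trunc_log_bounds (ltnSn 1) (ltn0Sn h).
set k := trunc_log 2 _ in k1 k2.
exists (r0 + k.+1); split; first exact: leq_addr.
  apply: leq_trans h2 _; rewrite leq_exp2l //; apply: ltnW; apply: leq_trans k2 _.
  by rewrite leq_exp2l // leq_addl.
exists h.+1.
  rewrite expnSr expnS expn1; apply: leq_mul => //; apply: leq_trans h1.
  by case: (h) => // h'; rewrite leq_exp2r.
by rewrite addnS expnS expnD expnS mulnA leq_mul2l k1 orbT.
Qed.

End Thresholds.

(** * From powers of two to powers of log N *)

Section Asymptotics.
Local Open Scope R_scope.

(** Here the [eps] in the exponent absorbs the logarithmic factors: with [c = e * ln 2 / 3], the
    power of [2 ^ r] is the cube of [exp (c * r)], which is at least [1 + c * r]. *)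
Lemma cube_le_Rpower (e : R) : 0 < e -> exists k, 0 < k /\
  forall r : nat, (INR r + 1) ^ 3 <= k * Rpower (2 ^ r) e.
Proof.
move=> e0; pose c := e * ln 2 / 3.
have l2 : 0 < ln 2 by rewrite -ln_1; apply: ln_increasing; Lra.lra.
have c0 : 0 < c by rewrite /c; apply: Rdiv_lt_0_compat; [exact: Rmult_lt_0_compat|Lra.lra].
have ic : 0 < / c by apply: Rinv_0_lt_compat.
exists ((1 + / c) ^ 3); split; first by apply: pow_lt; Lra.lra.
move=> r; have r0 := pos_INR r.
have -> : Rpower (2 ^ r) e = exp (c * INR r) ^ 3.
  rewrite /Rpower ln_pow; last by Lra.lra.
  rewrite -Rpower_pow /Rpower ?ln_exp; last exact: exp_pos.
  have -> : INR 3 = 3 by rewrite /=; Lra.lra.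
  by congr exp; rewrite /c; Lra.lra.
rewrite -Rpow_mult_distr; apply: pow_incr; split; first by Lra.lra.
have h := exp_ineq1_le (c * INR r).
have h1 : INR r + 1 <= (1 + / c) * (1 + c * INR r).
  have -> : (1 + / c) * (1 + c * INR r) = 1 + / c + c * INR r + / c * c * INR r by Lra.lra.
  rewrite Rinv_l; last by Lra.lra.
  have := Rmult_le_pos _ _ (Rlt_le _ _ c0) r0; Lra.lra.
apply: Rle_trans h1 _; apply: Rmult_le_compat_l => //; Lra.lra.
Qed.

Lemma level_asymptotics (t : nat) (C0 e : R) : 0 < C0 -> 0 < e -> exists k, 0 < k /\
  forall (r : nat) (l : R), 0 < l -> 2 ^ r <= C0 * l ->
    (2 ^ r) ^ t.+1 * (INR r + 1) ^ 3 <= k * Rpower l (INR t + 1 + e).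
Proof.
move=> C00 e0; have [k [k0 hk]] := cube_le_Rpower e0.
have pos2 r : 0 < 2 ^ r by apply: pow_lt; Lra.lra.
exists (k * Rpower C0 (INR t + 1 + e)); split.
  by apply: Rmult_lt_0_compat => //; apply: exp_pos.
move=> r l l0 hr.
have -> : (2 ^ r) ^ t.+1 = Rpower (2 ^ r) (INR t + 1) by rewrite -S_INR Rpower_pow.
apply: Rle_trans (_ : Rpower (2 ^ r) (INR t + 1) * (k * Rpower (2 ^ r) e) <= _).
  by apply: Rmult_le_compat_l => //; apply/Rlt_le/exp_pos.
have -> : Rpower (2 ^ r) (INR t + 1) * (k * Rpower (2 ^ r) e)
        = k * Rpower (2 ^ r) (INR t + 1 + e).
  by rewrite [Rpower _ (_ + e)]Rpower_plus; Lra.lra.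
rewrite Rmult_assoc; apply: Rmult_le_compat_l; first exact: Rlt_le.
rewrite Rpower_mult_distr //; apply: Rle_Rpower_l; first by have := pos_INR t; Lra.lra.
by split.
Qed.

End Asymptotics.

Open Scope R_scope.

Lemma INR_pow2 (r : nat) : INR (2 ^ r)%N = pow 2 r.
Proof. by rewrite INRE natrX RpowE. Qed.

Lemma level_log (N h r r0 : nat) : (1 < N)%N -> (2 ^ h <= N ^ 2)%N ->
  (2 ^ r <= 2 ^ r0.+1 * h)%N ->
  2 ^ r <= INR (2 ^ r0.+1)%N * (2 / ln 2) * ln (INR N).
Proof.
move=> N1 hN rh.
have l2 : 0 < ln 2 by rewrite -ln_1; apply: ln_increasing; Lra.lra.
have N0 : 0 < INR N by apply/lt_0_INR/ssrnat.ltP; apply: ltnW.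
have hl : INR h * ln 2 <= 2 * ln (INR N).
  rewrite -ln_pow; last by Lra.lra.
  have -> : 2 * ln (INR N) = ln (INR N ^ 2) by rewrite ln_pow.
  suff : 2 ^ h <= INR N ^ 2.
    case=> [lt|->]; last exact: Rle_refl.
    by apply/Rlt_le/ln_increasing => //; apply: pow_lt; Lra.lra.
  rewrite -INR_pow2; apply: Rle_trans (le_INR _ _ (ssrnat.leP hN)) _.
  by rewrite INRE natrX -INRE -RpowE; apply: Rle_refl.
have {}rh : 2 ^ r <= INR (2 ^ r0.+1)%N * INR h.
  by rewrite -INR_pow2 -mult_INR; apply/le_INR/ssrnat.leP.
apply: Rle_trans rh _; rewrite Rmult_assoc; apply: Rmult_le_compat_l; first exact: pos_INR.
apply: (Rmult_le_reg_r (ln 2)) => //; apply: Rle_trans hl _; apply: Req_le.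
rewrite /Rdiv.
have -> : 2 * / ln 2 * ln (INR N) * ln 2 = 2 * ln (INR N) * (/ ln 2 * ln 2) by Lra.lra.
by rewrite Rinv_l; Lra.lra.
Qed.

(** * The discrepancy bound for almost all series *)

Unset Implicit Arguments.

Theorem theorem4 (p t : nat) (b : 'I_t -> {poly 'F_p}) :
  prime p ->
  (forall i, b i \is monic) ->
  (forall i, (1 < size (b i))%N) ->
  (forall i j, i != j -> coprimep (b i) (b j)) ->
  haar_almost_all p (fun L : nat -> 'F_p =>
    forall eps : R, 0 < eps -> exists c : R, 0 < c /\
      forall N : nat, (2 <= N)%N ->
        INR N * star_disc p t b L N <= c * Rpower (ln (INR N)) (INR t + 1 + eps)).
Proof.
move=> pr _ b1 bco.
have b0 i : (b i != 0)%R by rewrite -size_poly_gt0 ltnW.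
(* Exceptional digit prefixes at scale [m = 2 ^ r]; their length [2 * m] determines the weight. *)
pose S r : {set 'rV['F_p]_(2 * 2 ^ r)} := [set v |
  (threshold t r <= bad_weight b (2 ^ r) (depth t r) (pdig (rVpoly v)))%N].
have cardS r : (#|S r| * (r.+1 * r.+2) <= p ^ (2 * 2 ^ r))%N.
  by apply: (card_bad_weight pr b0); rewrite expn_gt0.
move=> e e0; have [s [cover meas]] := haar_null_limsup pr cardS e0.
(* By contraposition: if from some [r0] on no prefix of [L] is exceptional, then the bound holds for
   [L], with constants depending on this [r0]. *)
exists s; split=> // L nP; apply: cover => r0; apply: NNPP => nbad; apply: nP.
have good r : (r0 <= r)%N -> (bad_weight b (2 ^ r) (depth t r) L < threshold t r)%N.
  move=> r0r; rewrite ltnNge; apply/negP => h; apply: nbad; exists r => //.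
  rewrite inE; apply: leq_trans h _; rewrite leq_eqVlt; apply/orP; left; apply/eqP.
  apply: (eq_bad_weight pr) => x xr.
  by rewrite /pdig (coef_rVpoly_ord (\row_i L i)%R (Ordinal xr)) mxE.
move=> eps eps0; set P := (\sum_i vbase (b i))%N.
have QP i : (vbase (b i) <= P)%N by rewrite /P (bigD1 i) //= leq_addr.
have l2 : 0 < ln 2 by rewrite -ln_1; apply: ln_increasing; Lra.lra.
pose C0 := INR (2 ^ r0.+1)%N * (2 / ln 2).
have C00 : 0 < C0.
  apply: Rmult_lt_0_compat; first by apply/lt_0_INR/ssrnat.ltP; rewrite expn_gt0.
  by apply: Rdiv_lt_0_compat => //; Lra.lra.
have [k [k0 hk]] := @level_asymptotics t C0 eps C00 eps0.
(* The additive rounding error [2 * t.+1] is multiplied by the threshold, which is at least 1, so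
   that one product bounds everything. *)
pose C1 := ((P ^ t * (p * (p + 2)) + 2 * t.+1) * (2 ^ t * 22 * t.+1))%N.
exists ((INR C1 + 1) * k); split.
  by apply: Rmult_lt_0_compat => //; have := pos_INR C1; Lra.lra.
move=> N N2; have [r [r0r Nr [h hN rh]]] := level_exists r0 (prime_gt1 pr) N2.
have lN : 0 < ln (INR N).
  by rewrite -ln_1; apply: ln_increasing; [Lra.lra|apply/(lt_INR 1)/ssrnat.ltP].
have {}hk := hk r _ lN (level_log N2 hN rh).
have bnd := star_disc_bound pr b1 bco (good r r0r) (threshold_depth t r (prime_gt1 pr))
  (threshold_ge t r) (ltnW N2) Nr QP.
set B := (_ + _)%N in bnd.
have BC : (B <= C1 * ((2 ^ r) ^ t.+1 * r.+1 ^ 3))%N.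
  rewrite /B /C1 -[leqRHS]mulnA; apply: leq_trans (leq_mul (leqnn _) (threshold_le t r)).
  by rewrite mulnDl leq_add2l leq_pmulr // threshold_gt0.
apply: Rle_trans (_ : INR B <= _); first by rewrite INRE [INR B]INRE; apply/RleP.
apply: Rle_trans (le_INR _ _ (ssrnat.leP BC)) _.
rewrite mult_INR.
have -> : INR ((2 ^ r) ^ t.+1 * r.+1 ^ 3)%N = (2 ^ r) ^ t.+1 * (INR r + 1) ^ 3.
  by rewrite mult_INR -S_INR -INR_pow2 !INRE !natrX -!RpowE.
rewrite Rmult_assoc; apply: Rle_trans (_ : (INR C1 + 1) * ((2 ^ r) ^ t.+1 * (INR r + 1) ^ 3) <= _).
  apply: Rmult_le_compat_r; last by Lra.lra.
  apply: Rmult_le_pos; first by apply/pow_le/pow_le; Lra.lra.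
  by apply: pow_le; have := pos_INR r; Lra.lra.
by apply: Rmult_le_compat_l => //; have := pos_INR C1; Lra.lra.
Qed.
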